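(* In the binary-state Bayesian Persuasion setting, there exist positive constants $C,c_1,c_2$ such that for any $\beta\in[0,\frac C4)$, any $\epsilon,x\in[0,1]$ and any discretization precision $\delta>0$ with $\delta\le\frac{\beta^2}{16}$, there exists a policy oracle $p_\delta(\cdot)$ which is a $$\Big(\tfrac{3\beta}{C}+c_2\sqrt\epsilon+2\sqrt\delta,\ \ \epsilon,\ \ \tfrac{x\,c_1\beta}{2},\ \ \max(x,\sqrt\delta)\Big)\text{-optimal stable policy oracle}$$ with output set of size $|\mathcal P_{\mathcal O}|=O(\frac{n^2}{\delta^2})$, where $n=|\mathcal S|$. Moreover, set $\epsilon=T^{-1/5}$, $x=\beta=\sqrt\epsilon$, $\delta=\frac{\beta^2}{16}$, and let $\sigma^\dagger$ be the mechanism using the choice rule $p_t=p_\delta(\pi_t)$ and the forecasting algorithm of Noarov et al. run for the events $\mathcal E=\mathcal E_1\cup\mathcal E_2\cup\mathcal E_3$, where, with $p^{\mathrm{opt}}(\pi)\in\arg\max_{p_0\in\mathcal P_0}V(a^*(p_0,\pi,\epsilon),p_0,\pi)$ and $a^{\mathrm{opt}}(\pi)=a^*(p^{\mathrm{opt}}(\pi),\pi,\epsilon)$: $\mathcal E_1=\{\mathbf 1[(p_\delta(\pi),a^*(p_\delta(\pi),\pi))=(p,r)]\}_{p\in\mathcal P_{\mathcal O},r\in\mathcal A}$, $\mathcal E_2=\{\mathbf 1[(p^{\mathrm{opt}}(\pi),a^{\mathrm{opt}}(\pi))=(p,a)]\}_{p\in\mathcal P_0,a\in\mathcal A}$, $\mathcal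 E_3=\{\mathbf 1[a^*(p_0,\pi)=a]\}_{p_0\in\mathcal P_0,a\in\mathcal A}$. If the Agent's learning algorithm $\mathcal L$ satisfies the No Secret Information assumption and the No Contextual Swap Regret assumption with $\epsilon_{\mathrm{swap}}=O(\sqrt{|\mathcal P_{\mathcal O}|/T})$, then $$\mathrm{PR}(\sigma^\dagger,\mathcal L,y_{1:T})=\tilde O\big(T^{-1/10}\big).$$
   Context: Binary-state Bayesian Persuasion. $\mathcal Y=\{0,1\}$; $\mathcal S\subset[0,1]$ is a finite strategy space. A policy is a signal scheme $p$ with signal space $\mathcal S$, i.e. distributions $p(\cdot|y)\in\Delta(\mathcal S)$ for $y\in\mathcal Y$ (attention is restricted to straightforward schemes: signal space $\mathcal S$, the Agent's best-responding strategy being the realized signal); $\mathcal P$ is the space of these, $\mathcal P_0\subseteq\mathcal P$ a finite benchmark set. An Agent action is a map $a:\mathcal S\to\mathcal S$ from signals to strategies; $\mathcal A$ is the set of these. The Agent has $u(s,y)\in[0,1]$; the Principal has $v(s)\in[0,1]$, independent of $y$. $U(a,p,y)=\mathbb E_{s\sim p(\cdot|y)}[u(a(s),y)]$, $V(a,p,y)=\mathbb E_{s\sim p(\cdot|y)}[v(a(s))]$. For $\mu\in[0,1]$, $u(s,\mu)=\mathbb E_{y\sim\mathrm{Ber}(\mu)}u(s,y)$. Standing assumption: for every $s\in\mathcal S$ there is $\mu\in[0,1]$ with $u(s,\mu)>u(s',\mu)$ for all $s'\ne s$. The constants $C,c_1,c_2$ depend only on this problem instance; $|\mathcal P_0|,|\mathcal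 A|,|\mathcal Y|$ and the instance are fixed independently of $T$; $\tilde O$ hides logarithmic factors. Discretization precisions $\delta$ are taken with $1/\delta$ a positive integer. General notation. For $\pi\in\Delta(\mathcal Y)$, $U(a,p,\pi)=\mathbb E_{y\sim\pi}U(a,p,y)$, $V(a,p,\pi)=\mathbb E_{y\sim\pi}V(a,p,y)$; for $\mu\in\Delta(\mathcal A)$, $U(\mu,p,y)=\mathbb E_{a\sim\mu}U(a,p,y)$, similarly $V(\mu,p,y)$. $a^*(p,\pi)$ is a fixed choice of element maximizing $V(\cdot,p,\pi)$ over $\arg\max_aU(a,p,\pi)$. $\mathcal B(p,\pi,\epsilon)=\{a:U(a,p,\pi)\ge U(a^*(p,\pi),p,\pi)-\epsilon\}$, $a^*(p,\pi,\epsilon)\in\arg\max_{a\in\mathcal B(p,\pi,\epsilon)}V(a,p,\pi)$. Argmax ties are broken by arbitrary fixed rules. States and actions are identified with one-hot vectors. Stability. A policy $p$ is $(\beta,\gamma)$-stable under $\pi$ if for every $a\ne a^*(p,\pi)$ either $U(a,p,\pi)\le U(a^*(p,\pi),p,\pi)-\beta$ or $V(a,p,\pi)\ge V(a^*(p,\pi),p,\pi)-\gamma$. $p$ is a $(c,\epsilon,\beta,\gamma)$-optimal stable policy under $\pi$ if it is $(\beta,\gamma)$-stable under $\pi$ and $V(a^*(p,\pi),p,\pi)\ge V(a^*(p_0,\pi,\epsilon),p_0,\pi)-c$ for all $p_0\in\mathcal P_0$. A $(c,\epsilon,\beta,\gamma)$-optimal stable policy oracle maps each $\pi\in\Delta(\mathcal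 Y)$ to such a policy; $\mathcal P_{\mathcal O}$ is its set of possible outputs. Interaction. A mechanism is a pair (forecasting algorithm $\mathcal F$, deterministic choice rule $\psi:\Delta(\mathcal Y)\to\mathcal P$). The state sequence $y_{1:T}$ is arbitrary. In round $t$: $\mathcal F$ (possibly randomized, based on the past but not on the Agent's actions) produces $\pi_t\in\Delta(\mathcal Y)$; the Principal announces $p_t=\psi(\pi_t)$ and recommendation $r_t=a^*(p_t,\pi_t)$; the Agent draws $a_t\sim\mathcal L_t(y_{1:t-1},a_{1:t-1},r_{1:t},p_{1:t})$; then $y_t$ is revealed. For $p_0\in\mathcal P_0$, the constant mechanism plays $p_0$ every round with recommendation $r_t^{p_0}=a^*(p_0,\pi_t)$ (same forecasts); $a^{p_0}_{1:T}$ are the actions $\mathcal L$ generates against it. $\mathrm{PR}(\psi,\pi_{1:T},\mathcal L,y_{1:T})=\max_{p_0\in\mathcal P_0}\mathbb E_{a_{1:T},a^{p_0}_{1:T}}\big[\frac1T\sum_t(V(a_t^{p_0},p_0,y_t)-V(a_t,p_t,y_t))\big]$, and $\mathrm{PR}((\mathcal F,\psi),\mathcal L,y_{1:T})=\mathbb E_{\pi_{1:T}}[\mathrm{PR}(\psi,\pi_{1:T},\mathcal L,y_{1:T})]$. No Contextual Swap Regret (parameter $\epsilon_{\mathrm{swap}}$): $\mathbb E_{a_{1:T}}\big[\max_{h:\mathcal P\times\mathcal A\times\mathcal A\to\mathcal A}\frac1T\sum_t(U(h(p_t,r_t,a_t),p_t,y_t)-U(a_t,p_t,y_t))\big]\le\epsilon_{\mathrm{swap}}$,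 and for all $p_0\in\mathcal P_0$ the same holds with $(p_t,r_t,a_t)$ replaced by $(p_0,r_t^{p_0},a_t^{p_0})$. No Secret Information: for every fixed forecast sequence and every $(p,r)$, with $n_{p,r}=|\{t:(p_t,r_t)=(p,r)\}|$ and $\hat\mu_{p,r}=\frac1{n_{p,r}}\sum_{t:(p_t,r_t)=(p,r)}a_t$, $\frac1{n_{p,r}}\mathbb E_{a_{1:T}}\big|\sum_{t:(p_t,r_t)=(p,r)}(U(a_t,p,y_t)-U(\hat\mu_{p,r},p,y_t))\big|\le O(1/\sqrt{n_{p,r}})$, and the same with $V$ in place of $U$; and for all $p_0\in\mathcal P_0$, $r\in\mathcal A$ the same two bounds hold for the constant mechanism, over the rounds with $r_t^{p_0}=r$, with actions $a_t^{p_0}$, policy $p_0$, their number $n_r^{p_0}$ and empirical action distribution $\hat\mu_r^{p_0}$. Forecasting algorithm (known result of Noarov, Ramalingam, Roth, Xie 2023, which may be used). An event is a function $E:\Delta(\mathcal Y)\to\{0,1\}$; $\pi_{1:T}$ has bias $\alpha$ conditional on $\mathcal E$ if $\frac1T\|\sum_tE(\pi_t)(\pi_t-y_t)\|_1\le\alpha(E)$ for all $E\in\mathcal E$. For any collection $\mathcal E$ of (polynomial-time evaluable) events there is a forecasting algorithm such that for every $y_{1:T}$ the expected conditional bias satisfies $\mathbb E_{\pi_{1:T}}[\alpha(E)]\le O\Big(\frac{|\mathcal Y|\ln(|\mathcal Y||\mathcal E|T)}{T}+\frac{|\mathcal Y|\sqrt{\ln(|\mathcal Y||\mathcal E|T)\,|\{t:E(\pi_t)=1\}|}}{T}\Big)$.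 *)

(* Defs.v *)
From HB Require Import structures.
From mathcomp Require Import all_boot all_order all_algebra finmap.
From mathcomp Require Import all_classical all_reals all_analysis.

Set Implicit Arguments.
Unset Strict Implicit.
Unset Printing Implicit Defensive.

Import Order.TTheory GRing.Theory Num.Theory.

Local Open Scope classical_set_scope.
Local Open Scope ring_scope.

Record dist (R : realType) (X : finType) := Dist {
  dist_fun :> {ffun X -> R};
  _ : [forall x, 0 <= dist_fun x] && (\sum_x dist_fun x == 1) }.

HB.instance Definition _ (R : realType) (X : finType) :=
  [isSub for @dist_fun R X].
HB.instance Definition _ (R : realType) (X : finType) :=
  [Choice of dist R X by <:].

(* The state space is [bool]: [true] is the state 1, [false] the state 0. *)
Definition belief (R : realType) := dist R bool.

(* Expected value of [f] when the state is Ber(mu). *)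
Definition Ber_mean (R : realType) (mu : R) (f : bool -> R) : R :=
  mu * f true + (1 - mu) * f false.

Record persuasion (R : realType) := Persuasion {
  strat : {fset R};
  strat01 : forall s, s \in strat -> 0 <= s <= 1;
  agent_u : strat -> bool -> R;
  agent_u01 : forall s y, 0 <= agent_u s y <= 1;
  principal_v : strat -> R;
  principal_v01 : forall s, 0 <= principal_v s <= 1;
  strat_undominated : forall s : strat, exists2 mu : R, 0 <= mu <= 1 &
    forall s' : strat, s' != s ->
      Ber_mean mu (agent_u s') < Ber_mean mu (agent_u s) }.

(* All signal schemes with signal space S.  A scheme is straightforward only
   relative to a prior, so this is not a restriction on the type; [p y s] is
   the probability of signal s in state y. *)
Definition policy (R : realType) (I : persuasion R) :=
  {ffun bool -> dist R (strat I)}.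

Definition action (R : realType) (I : persuasion R) :=
  {ffun strat I -> strat I}.

Definition U (R : realType) (I : persuasion R)
    (a : action I) (p : policy I) (y : bool) : R :=
  \sum_(s : strat I) p y s * agent_u (a s) y.

Definition V (R : realType) (I : persuasion R)
    (a : action I) (p : policy I) (y : bool) : R :=
  \sum_(s : strat I) p y s * principal_v (a s).

(* W(a, p, pi) for a prior pi, with W one of U and V. *)
Definition at_prior (R : realType) (I : persuasion R)
    (W : action I -> policy I -> bool -> R)
    (a : action I) (p : policy I) (pi : belief R) : R :=
  \sum_(y : bool) pi y * W a p y.

(* W(mu, p, y) for a mixed action mu, with W one of U and V. *)
Definition at_mixed (R : realType) (I : persuasion R)
    (W : action I -> policy I -> bool -> R)
    (mu : action I -> R) (p : policy I) (y : bool) : R :=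
  \sum_(a : action I) mu a * W a p y.

Definition best_response (R : realType) (I : persuasion R)
    (p : policy I) (pi : belief R) (a : action I) : Prop :=
  forall b : action I, at_prior (@U R I) b p pi <= at_prior (@U R I) a p pi.

(* The fixed argmax selections a*(p,pi) and a*(p,pi,eps). *)
Record tie_breaking (R : realType) (I : persuasion R) := TieBreaking {
  astar : policy I -> belief R -> action I;
  astar_eps : policy I -> belief R -> R -> action I;
  astarP : forall p pi, best_response p pi (astar p pi) /\
    forall b, best_response p pi b ->
      at_prior (@V R I) b p pi <= at_prior (@V R I) (astar p pi) p pi;
  astar_epsP : forall p pi eps, 0 <= eps ->
    let B a := at_prior (@U R I) (astar p pi) p pi - eps
                 <= at_prior (@U R I) a p pi in
    B (astar_eps p pi eps) /\
    forall b, B b ->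
      at_prior (@V R I) b p pi
        <= at_prior (@V R I) (astar_eps p pi eps) p pi }.

Definition stable (R : realType) (I : persuasion R) (tb : tie_breaking I)
    (beta gamma : R) (p : policy I) (pi : belief R) : Prop :=
  forall a : action I, a <> astar tb p pi ->
    at_prior (@U R I) a p pi
      <= at_prior (@U R I) (astar tb p pi) p pi - beta
    \/ at_prior (@V R I) a p pi
      >= at_prior (@V R I) (astar tb p pi) p pi - gamma.

Definition optimal_stable (R : realType) (I : persuasion R)
    (tb : tie_breaking I) (P0 : {fset policy I}) (c eps beta gamma : R)
    (p : policy I) (pi : belief R) : Prop :=
  stable tb beta gamma p pi /\
  forall p0, p0 \in P0 ->
    at_prior (@V R I) (astar tb p pi) p pi
      >= at_prior (@V R I) (astar_eps tb p0 pi eps) p0 pi - c.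

Definition optimal_stable_oracle (R : realType) (I : persuasion R)
    (tb : tie_breaking I) (P0 : {fset policy I}) (c eps beta gamma : R)
    (o : belief R -> policy I) : Prop :=
  forall pi, optimal_stable tb P0 c eps beta gamma (o pi) pi.

(* P_O, the set of possible outputs of the oracle, and its cardinality
   (meaningful when the set is finite). *)
Definition outputs (R : realType) (I : persuasion R)
    (o : belief R -> policy I) : set (policy I) := range o.

Definition n_outputs (R : realType) (I : persuasion R)
    (o : belief R -> policy I) : nat := #|` fset_set (outputs o) |.

(* A randomized forecaster draws a seed once and for all; [forecast w h] is the
   forecast made after the states [h] (oldest first), so the round is
   determined by [size h].  Past forecasts are functions of the seed and of the
   past states, hence this covers dependence on the whole past. *)
Record forecaster (R : realType) := Forecaster {
  seed_display : measure_display;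
  seed : measurableType seed_display;
  seed_law : probability seed R;
  forecast : seed -> seq bool -> belief R;
  forecast_measurable : forall (h : seq bool) (y : bool),
    measurable_fun setT (fun w => forecast w h y) }.

Definition forecasts (R : realType) (F : forecaster R) (w : seed F)
    (T : nat) (y : T.-tuple bool) : T.-tuple (belief R) :=
  [tuple forecast w (take t y) | t < T].

(* (1/T) || sum_t E(pi_t) (pi_t - y_t) ||_1, states being one-hot vectors. *)
Definition bias (R : realType) (T : nat) (E : belief R -> bool)
    (pi : T.-tuple (belief R)) (y : T.-tuple bool) : R :=
  T%:R^-1 * \sum_(z : bool)
    `| \sum_(t < T) (E (tnth pi t))%:R * (tnth pi t z - (tnth y t == z)%:R) |.

Definition n_rounds (R : realType) (T : nat) (E : belief R -> bool)
    (pi : T.-tuple (belief R)) : nat := #|[set t : 'I_T | E (tnth pi t)]%SET|.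

Definition bias_rate (R : realType) (T : nat) (EE : set (belief R -> bool))
    (E : belief R -> bool) (pi : T.-tuple (belief R)) : R :=
  let nY := #|{: bool}| in
  let l := ln ((nY * #|` fset_set EE | * T)%N%:R) in
  nY%:R * l / T%:R + nY%:R * Num.sqrt (l * (n_rounds E pi)%:R) / T%:R.

(* The conditional bias guarantee for the events [EE], with [K] the constant of
   the O.  The rate involves the random number of rounds in which the event
   occurs, hence the expectation on the right.  The first conjunct says that
   the probabilities of the events are defined. *)
Definition unbiased_forecaster (R : realType) (K : R) (T : nat)
    (EE : set (belief R -> bool)) (F : forecaster R) : Prop :=
  forall E, EE E ->
    (forall h : seq bool, measurable [set w : seed F | E (forecast w h)]) /\
    forall y : T.-tuple bool,
      ('E_(seed_law F)[(fun w => bias E (forecasts w y) y)]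
         <= K%:E * 'E_(seed_law F)[(fun w => bias_rate EE E (forecasts w y))])%E.

(* [L y_{1:t-1} a_{1:t-1} r_{1:t} p_{1:t}] is the law of a_t. *)
Definition learner (R : realType) (I : persuasion R) :=
  seq bool -> seq (action I) -> seq (action I) -> seq (policy I) ->
  dist R (action I).

(* Expectation of [f a_{1:T}] when the Agent faces the policies [ps] and the
   recommendations [rs]. *)
Definition E_actions (R : realType) (I : persuasion R) (L : learner I)
    (T : nat) (y : T.-tuple bool) (ps : T.-tuple (policy I))
    (rs : T.-tuple (action I)) (f : T.-tuple (action I) -> R) : R :=
  \sum_(a : T.-tuple (action I))
    (\prod_(t < T)
       L (take t y) (take t a) (take t.+1 rs) (take t.+1 ps) (tnth a t)) * f a.

Definition play_policies (R : realType) (I : persuasion R)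
    (psi : belief R -> policy I) (T : nat) (pi : T.-tuple (belief R)) :
    T.-tuple (policy I) := [tuple psi (tnth pi t) | t < T].

Definition play_recs (R : realType) (I : persuasion R) (tb : tie_breaking I)
    (psi : belief R -> policy I) (T : nat) (pi : T.-tuple (belief R)) :
    T.-tuple (action I) :=
  [tuple astar tb (psi (tnth pi t)) (tnth pi t) | t < T].

(* Expectation over the actions when the choice rule is [psi]; the constant
   mechanism of p0 is the choice rule [fun=> p0]. *)
Definition E_play (R : realType) (I : persuasion R) (tb : tie_breaking I)
    (L : learner I) (psi : belief R -> policy I) (T : nat)
    (pi : T.-tuple (belief R)) (y : T.-tuple bool)
    (f : T.-tuple (action I) -> R) : R :=
  E_actions L y (play_policies psi pi) (play_recs tb psi pi) f.

(* PR(psi, pi_{1:T}, L, y_{1:T}); the supremum is over a finite set. *)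
Definition PR_forecasts (R : realType) (I : persuasion R)
    (tb : tie_breaking I) (P0 : {fset policy I}) (L : learner I)
    (psi : belief R -> policy I) (T : nat) (pi : T.-tuple (belief R))
    (y : T.-tuple bool) : R :=
  sup [set E_play tb L psi pi y (fun a =>
           E_play tb L (fun=> p0) pi y (fun a0 =>
             T%:R^-1 * \sum_(t < T)
               (V (tnth a0 t) p0 (tnth y t)
                - V (tnth a t) (psi (tnth pi t)) (tnth y t))))
      | p0 in [set p0 | p0 \in P0]].

Definition PR (R : realType) (I : persuasion R)
    (tb : tie_breaking I) (P0 : {fset policy I}) (L : learner I)
    (sigma : forecaster R * (belief R -> policy I)) (T : nat)
    (y : T.-tuple bool) : \bar R :=
  'E_(seed_law sigma.1)[(fun w =>
     PR_forecasts tb P0 L sigma.2 (forecasts w y) y)]%E.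

Definition swap_regret_le (R : realType) (I : persuasion R)
    (tb : tie_breaking I) (L : learner I) (psi : belief R -> policy I)
    (T : nat) (pi : T.-tuple (belief R)) (y : T.-tuple bool)
    (eps_swap : R) : Prop :=
  let ps := play_policies psi pi in
  let rs := play_recs tb psi pi in
  E_play tb L psi pi y (fun a =>
    sup (range (fun h : policy I * action I * action I -> action I =>
      T%:R^-1 * \sum_(t < T)
        (U (h (tnth ps t, tnth rs t, tnth a t)) (tnth ps t) (tnth y t)
         - U (tnth a t) (tnth ps t) (tnth y t)))))
  <= eps_swap.

Definition no_contextual_swap_regret (R : realType) (I : persuasion R)
    (tb : tie_breaking I) (P0 : {fset policy I}) (L : learner I)
    (psi : belief R -> policy I) (T : nat) (pi : T.-tuple (belief R))
    (y : T.-tuple bool) (eps_swap : R) : Prop :=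
  swap_regret_le tb L psi pi y eps_swap /\
  forall p0, p0 \in P0 -> swap_regret_le tb L (fun=> p0) pi y eps_swap.

Definition empirical (R : realType) (I : persuasion R) (T : nat)
    (J : {set 'I_T}) (a : T.-tuple (action I)) : action I -> R :=
  fun b => #|J|%:R^-1 * \sum_(t in J) (tnth a t == b)%:R.

Definition no_secret_info_play (R : realType) (I : persuasion R)
    (tb : tie_breaking I) (L : learner I) (psi : belief R -> policy I)
    (T : nat) (pi : T.-tuple (belief R)) (y : T.-tuple bool) (K : R) : Prop :=
  forall (p : policy I) (r : action I),
    let J := [set t : 'I_T | (tnth (play_policies psi pi) t,
                              tnth (play_recs tb psi pi) t) == (p, r)]%SET in
    let gap (W : action I -> policy I -> bool -> R) :=
      #|J|%:R^-1 * E_play tb L psi pi y (fun a =>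
        `| \sum_(t in J) (W (tnth a t) p (tnth y t)
                          - at_mixed W (empirical J a) p (tnth y t)) |) in
    (0 < #|J|)%N ->
    gap (@U R I) <= K / Num.sqrt #|J|%:R /\
    gap (@V R I) <= K / Num.sqrt #|J|%:R.

(* For the constant mechanism of p0 the rounds with (p_t, r_t) = (p, r) are
   those with r_t = r if p = p0, and there are none otherwise. *)
Definition no_secret_information (R : realType) (I : persuasion R)
    (tb : tie_breaking I) (P0 : {fset policy I}) (L : learner I)
    (psi : belief R -> policy I) (T : nat) (pi : T.-tuple (belief R))
    (y : T.-tuple bool) (K : R) : Prop :=
  no_secret_info_play tb L psi pi y K /\
  forall p0, p0 \in P0 -> no_secret_info_play tb L (fun=> p0) pi y K.

Definition is_popt (R : realType) (I : persuasion R) (tb : tie_breaking I)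
    (P0 : {fset policy I}) (eps : R) (popt : belief R -> policy I) : Prop :=
  forall pi, popt pi \in P0 /\
    forall p0, p0 \in P0 ->
      at_prior (@V R I) (astar_eps tb p0 pi eps) p0 pi
        <= at_prior (@V R I) (astar_eps tb (popt pi) pi eps) (popt pi) pi.

Definition events1 (R : realType) (I : persuasion R) (tb : tie_breaking I)
    (psi : belief R -> policy I) : set (belief R -> bool) :=
  [set (fun pi => (psi pi, astar tb (psi pi) pi) == (p, r))
     | p in outputs psi & r in [set: action I]].

Definition events2 (R : realType) (I : persuasion R) (tb : tie_breaking I)
    (P0 : {fset policy I}) (eps : R) (popt : belief R -> policy I) :
    set (belief R -> bool) :=
  [set (fun pi => (popt pi, astar_eps tb (popt pi) pi eps) == (p, a))
     | p in [set p | p \in P0] & a in [set: action I]].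

Definition events3 (R : realType) (I : persuasion R) (tb : tie_breaking I)
    (P0 : {fset policy I}) : set (belief R -> bool) :=
  [set (fun pi => astar tb p0 pi == a)
     | p0 in [set p | p \in P0] & a in [set: action I]].

(* Main.v *)
(** Oracle.  Any two strategies are ordered oppositely in the two states, so a
    single constant g bounds below the margin of every strategy at some belief
    and the payoff differences in both states.  Hence a signal that is obeyed up
    to a regret r can be made strictly obeyed, with margin of order b, by
    revealing a mass O(b + r) of one state; the revealed mass goes to the
    strategies best at the extreme beliefs.  A policy all of whose signals are
    strictly obeyed is stable, and this property survives small changes of the
    prior.  It therefore suffices to fix one policy per cell of a grid of priors
    of mesh delta^2, and an uninformative policy for priors within delta of 0
    or 1; no discretization of the policies themselves is needed.

    Regret.  Within the rounds sharing a policy and a recommendation, No Secret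
    Information and the conditional bias let one replace the realized values by
    those of the empirical mix of actions at the forecasts.  Swapping every
    action for the recommendation bounds the mix's utility loss at the
    forecasts; stability turns this loss, divided by the stability parameter,
    into a bound on the Principal's loss, and dividing it by eps bounds the
    excess of the benchmark over a*(p0, pi, eps).  Cauchy-Schwarz over the cells
    and tau = T^(-1/10) (so eps = tau^2, 1/T = tau^10) give the rate. *)

Require Import Defs.
From mathcomp Require Import all_boot all_order all_algebra finmap.
From mathcomp Require Import all_classical all_reals all_analysis.
From mathcomp Require Import measurable_realfun ring lra.

Set Implicit Arguments.
Unset Strict Implicit.
Unset Printing Implicit Defensive.

Import Order.TTheory GRing.Theory Num.Theory.
Import numFieldNormedType.Exports.

Local Open Scope classical_set_scope.
Local Open Scope ring_scope.

(** * Removing mass from a single signal *)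

Section OneSignal.
Variables (R : realType) (T : Type) (al be : T -> R) (mu g k : R).

(* When the signal is kept, state-0 mass is removed so that the masses become
   a positive combination of (A, B) and (mu, 1 - mu). *)
Lemma trim_signal_below (A B r b : R) :
  0 <= mu <= 1 -> 0 < g <= 1 -> 0 < k <= 1 -> 0 <= b <= 1 ->
  (forall i, g <= mu * al i + (1 - mu) * be i) ->
  0 <= A -> 0 <= B -> 0 <= r -> A * (1 - mu) <= B * mu ->
  (forall i, - r <= A * al i + B * be i) ->
  (forall i, g <= be i) \/ k * (A + B) <= A \/ k * (A + B) <= r ->
  exists A' B', [/\ 0 <= A' <= A, 0 <= B' <= B,
    A + B - (A' + B') <= b * (A + B) + r / (k * g) &
    forall i, k * g * b * (A' + B') <= A' * al i + B' * be i].
Proof.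
move=> /andP[mu0 mu1] /andP[g0 g1] /andP[k0 k1] /andP[b0 b1] Hg A0 B0 r0 Hmu Hr.
have kg0 : 0 < k * g by rewrite mulr_gt0.
have rkg0 : 0 <= r / (k * g) by rewrite divr_ge0 // ltW.
have kgb : k * g * b <= g.
  have : k * g * b <= 1 * g * 1.
    by rewrite ler_pM ?mulr_ge0 ?(ltW k0) ?(ltW g0)// ler_wpM2r// ltW.
  by rewrite mul1r mulr1.
(* For [mu = 0] the hypotheses force [A = 0] and [g <= be i], so nothing has to be removed;
   afterwards division by [mu] is legitimate. *)
have [mu_eq0|mu_neq0] := eqVneq mu 0.
  have A_eq0 : A = 0.
    by apply/eqP; rewrite eq_le A0 andbT; move: Hmu; rewrite mu_eq0; lra.
  move=> _; exists A, B; rewrite A_eq0 lexx B0 lexx; split=> //.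
    by rewrite subrr addr_ge0// mulr_ge0// add0r.
  move=> i; have := Hg i; rewrite mu_eq0 mul0r !add0r subr0 mul1r => Hb.
  by rewrite [leRHS]mulrC ler_wpM2r// (le_trans kgb).
have mu_gt0 : 0 < mu by rewrite lt0r mu_neq0.
have excess : 0 <= B - A * (1 - mu) / mu by rewrite subr_ge0 ler_pdivrMr.
(* In the first case nothing is removed either: [(A, B)] is [A / mu] times [(mu, 1 - mu)] plus a
   nonnegative multiple of [(0, 1)], and both directions have margin [g]. *)
case=> [Hb|Hk].
  exists A, B; rewrite A0 B0 !lexx; split=> //.
    by rewrite subrr addr_ge0// mulr_ge0// addr_ge0.
  move=> i.
  have -> : A * al i + B * be i = A / mu * (mu * al i + (1 - mu) * be i)
      + (B - A * (1 - mu) / mu) * be i by field.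
  have : A / mu * g <= A / mu * (mu * al i + (1 - mu) * be i).
    by rewrite ler_wpM2l// divr_ge0.
  have : (B - A * (1 - mu) / mu) * g <= (B - A * (1 - mu) / mu) * be i.
    by rewrite ler_wpM2l.
  have : k * g * b * (A + B) <= g * (A + B) by rewrite ler_wpM2r// addr_ge0.
  have : (B - A * (1 - mu) / mu) * g + A / mu * g = g * (A + B) by field.
  lra.
(* A signal whose whole mass is within the permitted loss is dropped. This covers
   [k * (A + B) <= r], so that otherwise [A] is abundant. *)
have [kill|keep] := leP (A + B) (b * (A + B) + r / (k * g)).
  exists 0, 0; rewrite !lexx A0 B0 addr0 subr0; split=> // i.
  by rewrite !mul0r mulr0 addr0.
have q0 : 0 < A + B.
  rewrite lt0r addr_ge0// andbT; apply/eqP => q_eq0.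
  by move: keep; rewrite q_eq0 mulr0 add0r ltNge rkg0.
have {Hk} HA : k * (A + B) <= A.
  case: Hk => // Hk; exfalso; move: keep; apply/negP; rewrite -leNgt.
  have : A + B <= r / (k * g).
    rewrite ler_pdivlMr//; apply: le_trans Hk.
    rewrite mulrA [leRHS]mulrC ler_piMr ?mulr_ge0 ?addr_ge0 ?(ltW k0)//.
  have : 0 <= b * (A + B) by rewrite mulr_ge0// ltW.
  lra.
(* [t] is the fraction of the excess [B - A * (1 - mu) / mu] that is removed; the excess is at most
   [A + B], so the loss is as permitted. What is kept is [1 - t] times [(A, B)], which costs at most
   [r], plus [t * A / mu] times [(mu, 1 - mu)], which gains at least [k * g * b * (A + B) + r]. *)
set t := b + r / (k * g) / (A + B).
have t0 : 0 <= t by rewrite addr_ge0// divr_ge0// ltW.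
have tq : t * (A + B) = b * (A + B) + r / (k * g).
  by rewrite /t mulrDl divfK// gt_eqF.
have t1 : t < 1 by rewrite -(ltr_pM2r q0) tq mul1r.
exists A, (B - t * (B - A * (1 - mu) / mu)); split.
- by rewrite A0 lexx.
- apply/andP; split; last by rewrite gerBl mulr_ge0.
  have -> : B - t * (B - A * (1 - mu) / mu) = (1 - t) * B + t * (A * (1 - mu) / mu).
    by field.
  by rewrite addr_ge0// mulr_ge0// ?divr_ge0// ?mulr_ge0//; lra.
- rewrite -tq.
  have : t * (B - A * (1 - mu) / mu) <= t * (A + B).
    rewrite ler_wpM2l//.
    have : 0 <= A * (1 - mu) / mu by rewrite divr_ge0// mulr_ge0//; lra.
    lra.
  lra.
move=> i.
have -> : A * al i + (B - t * (B - A * (1 - mu) / mu)) * be i =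
  (1 - t) * (A * al i + B * be i) + t * (A / mu * (mu * al i + (1 - mu) * be i)).
  by field.
have h1 : - r <= (1 - t) * (A * al i + B * be i).
  have : (1 - t) * - r <= (1 - t) * (A * al i + B * be i).
    by rewrite ler_wpM2l//; lra.
  have : 0 <= t * r by rewrite mulr_ge0.
  lra.
have h2 : t * (k * (A + B) * g) <= t * (A / mu * (mu * al i + (1 - mu) * be i)).
  rewrite ler_wpM2l// ler_pM ?Hg ?mulr_ge0 ?(ltW k0) ?(ltW g0) ?(ltW q0)//.
  by apply: le_trans HA _; rewrite ler_peMr// invf_ge1.
have h3 : t * (k * (A + B) * g) = k * g * b * (A + B) + r.
  have -> : t * (k * (A + B) * g) = k * g * (t * (A + B)) by ring.
  by rewrite tq; field; rewrite !gt_eqF.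
have h4 : k * g * b * (A + (B - t * (B - A * (1 - mu) / mu)))
   <= k * g * b * (A + B).
  by rewrite ler_wpM2l ?lerD2l ?gerBl ?mulr_ge0 ?(ltW k0) ?(ltW g0).
lra.
Qed.

End OneSignal.

(** * Strictly obeyed signals *)

(** The witness is the minimum of finitely many margins, capped at 1. *)
Lemma uniform_positive (R : realType) (X : finType) (P : X -> R -> Prop) :
  (forall x, exists2 g, 0 < g & P x g) ->
  (forall x g g', 0 < g' <= g -> P x g -> P x g') ->
  exists2 g, 0 < g <= 1 & forall x, P x g.
Proof.
move=> exg Pmono; have /choice[f fP] : forall x, exists g, 0 < g /\ P x g.
  by move=> x; have [g ? ?] := exg x; exists g.
have g0 : 0 < \big[Num.min/1]_x f x.
  by apply/bigmin_gtP; split=> // x _; have [] := fP x.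
exists (\big[Num.min/1]_x f x); first by rewrite g0 bigmin_le_id.
move=> x; apply: Pmono (proj2 (fP x)); rewrite g0/=.
exact: bigmin_le_cond.
Qed.

Section Instance.
Variables (R : realType) (I : persuasion R).
Implicit Types (s : strat I) (y : bool).

Definition lead s s' y : R := agent_u s y - agent_u s' y.

Lemma lead_antisym s s' y : lead s s' y = - lead s' s y.
Proof. by rewrite /lead opprB. Qed.

Lemma lead_bounds s s' y : -1 <= lead s s' y <= 1.
Proof.
by rewrite /lead; have := agent_u01 s y; have := agent_u01 s' y; lra.
Qed.

Lemma Ber_mean_lead s s' mu :
  Ber_mean mu (agent_u s) - Ber_mean mu (agent_u s') =
  mu * lead s s' true + (1 - mu) * lead s s' false.
Proof. by rewrite /Ber_mean /lead; ring. Qed.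

(** Each of the two strategies beats the other at some belief; if the leads had weakly the same
    sign, one strategy would be at least as good at every belief. *)
Lemma lead_opposite s s' : s' != s -> lead s s' true * lead s s' false < 0.
Proof.
move=> ss'.
have [m /andP[m0 m1] /(_ _ ss')] := strat_undominated s.
rewrite -subr_gt0 Ber_mean_lead => Hm.
have [m' /andP[m'0 m'1] /(_ s)] := strat_undominated s'.
rewrite eq_sym ss' => /(_ isT).
rewrite -subr_gt0 Ber_mean_lead (lead_antisym s') (lead_antisym s') => Hm'.
set a := lead s s' true in Hm Hm' *; set b := lead s s' false in Hm Hm' *.
rewrite ltNge; apply/negP => ab.
have [a0|a0] := ltP a 0.
  have b0 : b <= 0 by nra.
  have : m * a <= 0 by nra.
  have : (1 - m) * b <= 0 by nra.
  lra.
have [b0|b0] := ltP b 0.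
  have a_eq0 : a <= 0 by nra.
  have : m * a <= 0 by nra.
  have : (1 - m) * b <= 0 by nra.
  lra.
have : 0 <= m' * a by nra.
have : 0 <= (1 - m') * b by nra.
lra.
Qed.

Lemma lead_neq0 s s' y : s' != s -> lead s s' y != 0.
Proof.
move=> /lead_opposite h; apply/eqP => l0; move: h.
by case: y l0 => ->; rewrite ?mulr0 ?mul0r ltxx.
Qed.

(** The constants of the theorem are all read off such a [g]: [C = g^2 / 4], [c1 = g^2 / 8] and
    [c2 = 4 / g^2]. *)
Definition separation (g : R) : Prop :=
  [/\ 0 < g <= 1,
    forall s, exists2 mu, 0 <= mu <= 1 & forall s', s' != s ->
      g <= mu * lead s s' true + (1 - mu) * lead s s' false &
    forall s s' y, s' != s -> g <= `|lead s s' y| ].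

Lemma separation_exists : exists g, separation g.
Proof.
have [|s g g' /andP[_ g'g] [mu mu01 H]|g1 /andP[g10 g11] H1] := @uniform_positive R (strat I)
  (fun s g => exists2 mu, 0 <= mu <= 1 & forall s', s' != s ->
      g <= mu * lead s s' true + (1 - mu) * lead s s' false).
- move=> s; have [mu mu01 H] := strat_undominated s.
  have [|s' g g' /andP[_ g'g] Hg /Hg|g1 /andP[g10 _] H1] :=
    @uniform_positive R (strat I)
    (fun s' g => s' != s -> g <= mu * lead s s' true + (1 - mu) * lead s s' false).
  + move=> s'; have [->|ss'] := eqVneq s' s; first by exists 1.
    exists (mu * lead s s' true + (1 - mu) * lead s s' false) => //.
    by rewrite -Ber_mean_lead subr_gt0 H.
  + exact: le_trans.
  + by exists g1 => //; exists mu.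
- by exists mu => // s' /H; exact: le_trans.
have [|x g g' /andP[_ g'g] Hg /Hg|g2 /andP[g20 g21] H2] :=
    @uniform_positive R (strat I * strat I * bool)%type
    (fun x g => x.1.2 != x.1.1 -> g <= `|lead x.1.1 x.1.2 x.2|).
- move=> [[s s'] y]/=; have [->|ss'] := eqVneq s' s; first by exists 1.
  by exists `|lead s s' y| => //; rewrite normr_gt0 lead_neq0.
- exact: le_trans.
exists (Num.min g1 g2); split.
- by rewrite lt_min g10 g20 ge_min g11.
- move=> s; have [mu mu01 H] := H1 s; exists mu => // s' /H.
  by apply: le_trans; rewrite ge_min lexx.
- move=> s s' y ss'; have := H2 (s, s', y) ss'.
  by apply: le_trans; rewrite ge_min lexx orbT.
Qed.

Definition best_at y s : Prop := forall s', agent_u s' y <= agent_u s y.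

Lemma best_at_exists y : strat I -> exists s, best_at y s.
Proof.
move=> s0; case: (@arg_maxP _ _ _ s0 xpredT (fun s => agent_u s y)) => // s _ H.
by exists s => s'; exact: H.
Qed.

Section Separated.
Variables (g : R) (sep : separation g).

Lemma sep01 : 0 < g <= 1. Proof. by case: sep. Qed.

Lemma best_at_lead y s s' : best_at y s -> s' != s -> g <= lead s s' y.
Proof.
move=> best ss'; have [_ _ /(_ _ _ y ss')] := sep.
by rewrite ger0_norm// subr_ge0.
Qed.

(* A signal recommending s carries little mass of the state y only if it is
   heavily disobeyed: the strategy that is best in the other state is then
   better than s by a definite amount. *)
Lemma rare_state_regret y s z (A B r : R) :
  best_at (~~ y) z -> s != z -> 0 <= A -> 0 <= B ->
  (forall s', s' != s -> - r <= A * lead s s' y + B * lead s s' (~~ y)) ->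
  g / 4 * (A + B) <= A \/ g / 4 * (A + B) <= r.
Proof.
move=> best sz A0 B0 /(_ z); rewrite eq_sym sz => /(_ isT) Hr.
have [|HA] := leP (g / 4 * (A + B)) A; [by left|right].
have := best_at_lead best sz; have /andP[_] := lead_bounds s z y.
rewrite (lead_antisym z) => l1 l2; have /andP[g0 g1] := sep01.
have h1 : A * lead s z y <= A by rewrite ler_piMr.
have h2 : B * g <= B * - lead s z (~~ y) by rewrite ler_wpM2l.
have h3 : g * A <= g * (g / 4 * (A + B)) by rewrite ler_wpM2l// ltW.
have h4 : g * (g * (A + B)) <= 1 * (g * (A + B)).
  by rewrite ler_wpM2r ?mulr_ge0 ?addr_ge0// ltW.
lra.
Qed.

(** The side condition of the trimming holds with [k = g / 4]: either [s] is itself the best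
    strategy in state [~~ y] and leads there by [g], or [rare_state_regret] applies. *)
Lemma trim_signal_side y s z mu (A B r b : R) :
  best_at (~~ y) z -> 0 <= mu <= 1 -> 0 <= b <= 1 ->
  (forall s', s' != s -> g <= mu * lead s s' y + (1 - mu) * lead s s' (~~ y)) ->
  0 <= A -> 0 <= B -> 0 <= r -> A * (1 - mu) <= B * mu ->
  (forall s', s' != s -> - r <= A * lead s s' y + B * lead s s' (~~ y)) ->
  exists A' B', [/\ 0 <= A' <= A, 0 <= B' <= B,
    A + B - (A' + B') <= b * (A + B) + r / (g ^+ 2 / 4) &
    forall s', s' != s -> g ^+ 2 / 4 * b * (A' + B') <=
      A' * lead s s' y + B' * lead s s' (~~ y)].
Proof.
move=> best mu01 b01 Hg A0 B0 r0 Hmu Hr; have /andP[g0 g1] := sep01.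
have G : g / 4 * g = g ^+ 2 / 4 by rewrite expr2; ring.
have [||||A' [B' [HA HB Hm H]]] := @trim_signal_below R {s' | s' != s}
  (fun i => lead s (val i) y) (fun i => lead s (val i) (~~ y)) mu g (g / 4)
  A B r b mu01 sep01 _ b01 _ A0 B0 r0 Hmu.
- by lra.
- by case.
- by case.
- have [sz|sz] := eqVneq s z; last by right; exact: rare_state_regret Hr.
  by left => -[s' ss']; apply: best_at_lead ss'; rewrite sz.
exists A', B'; rewrite -G; split=> // s' ss'.
exact: H (exist _ s' ss').
Qed.

(** The posterior of the signal lies on one side of the belief [mu] at which [s] has margin [g]; the
    other side is reduced to the first by exchanging the states, and [mu] with [1 - mu]. *)
Lemma trim_signal s bot top (A B r b : R) :
  best_at false bot -> best_at true top -> 0 <= b <= 1 ->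
  0 <= A -> 0 <= B -> 0 <= r ->
  (forall s', s' != s -> - r <= A * lead s s' true + B * lead s s' false) ->
  exists A' B', [/\ 0 <= A' <= A, 0 <= B' <= B,
    A + B - (A' + B') <= b * (A + B) + r / (g ^+ 2 / 4) &
    forall s', s' != s -> g ^+ 2 / 4 * b * (A' + B') <=
      A' * lead s s' true + B' * lead s s' false].
Proof.
move=> bbot btop b01 A0 B0 r0 Hr.
have [_ /(_ s)[mu mu01 Hmu] _] := sep.
have [low|up] := leP (A * (1 - mu)) (B * mu).
  exact: (@trim_signal_side true s bot mu).
have [|s' ss'||s' ss'|B' [A' [? ? Hm H]]] :=
  @trim_signal_side false s top (1 - mu) B A r b btop _ b01 _ B0 A0 r0.
- by lra.
- by rewrite subKr addrC; exact: Hmu.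
- by rewrite subKr ltW.
- by rewrite addrC; exact: Hr.
exists A', B'; split=> //; first by move: Hm; rewrite ![B + A]addrC [B' + A']addrC.
by move=> s' /H; rewrite [B' + _]addrC [leRHS]addrC.
Qed.

End Separated.
End Instance.

(** * Finite distributions and binary beliefs *)

Lemma sum_bool (R : realType) (y : bool) (F : bool -> R) :
  \sum_y' F y' = F y + F (~~ y).
Proof. by rewrite big_bool; case: y => //=; rewrite addrC. Qed.

Section Dist.
Variables (R : realType) (X : finType).

Lemma dist_ge0 (d : dist R X) x : 0 <= d x.
Proof. by case: d => d /= /andP[/forallP]. Qed.

Lemma dist_sum (d : dist R X) : \sum_x d x = 1.
Proof. by case: d => d /= /andP[_ /eqP]. Qed.

Lemma dist_le1 (d : dist R X) x : d x <= 1.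
Proof.
rewrite -(dist_sum d) (bigD1 x)//= lerDl sumr_ge0// => x' _; exact: dist_ge0.
Qed.

Lemma dist_of (f : X -> R) : (forall x, 0 <= f x) -> \sum_x f x = 1 ->
  exists d : dist R X, forall x, d x = f x.
Proof.
move=> f0 f1; have H : [forall x, 0 <= [ffun x => f x] x] &&
    (\sum_x [ffun x => f x] x == 1).
  apply/andP; split; first by apply/forallP => x; rewrite ffunE.
  by rewrite -f1; apply/eqP; apply: eq_bigr => x _; rewrite ffunE.
by exists (Dist H) => x; rewrite /= ffunE.
Qed.

End Dist.

Lemma belief_sum (R : realType) (pi : belief R) y : pi y + pi (~~ y) = 1.
Proof. by rewrite -(dist_sum pi) (sum_bool y). Qed.

Lemma belief_of (R : realType) (m : R) : 0 <= m <= 1 ->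
  exists pi : belief R, pi true = m /\ pi false = 1 - m.
Proof.
move=> m01; have [y||pi H] := @dist_of R bool (fun y => if y then m else 1 - m).
- by case: y; lra.
- by rewrite big_bool/=; ring.
by exists pi; rewrite !H.
Qed.

(** * Obedience, stability and direct schemes *)

Section Schemes.
Variables (R : realType) (I : persuasion R).
Implicit Types (s : strat I) (p : policy I) (pi : belief R) (a : action I).

Notation payoff_u a p pi := (at_prior (@U R I) a p pi).
Notation payoff_v a p pi := (at_prior (@V R I) a p pi).

Lemma policy_of (f : bool -> strat I -> R) : (forall y s, 0 <= f y s) ->
  (forall y, \sum_s f y s = 1) -> exists p : policy I, forall y s, p y s = f y s.
Proof.
move=> f0 f1.
have /choice[q qE] : forall y, exists d : dist R (strat I), forall s, d s = f y s.
  by move=> y; exact: dist_of.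
by exists [ffun y => q y] => y s; rewrite ffunE.
Qed.

(** Signal probabilities sum to 1, so the existence of a policy makes the strategy space
    inhabited. *)
Lemma policy_strat (p : policy I) : strat I.
Proof.
case: (pickP (@predT (strat I))) => // no_s; exfalso.
by have := dist_sum (p true); rewrite big_pred0// => /esym/eqP; rewrite oner_eq0.
Qed.

Definition signal_prob p pi s : R := \sum_y pi y * p y s.

Lemma signal_prob_ge0 p pi s : 0 <= signal_prob p pi s.
Proof. by rewrite sumr_ge0// => y _; rewrite mulr_ge0// dist_ge0. Qed.

Lemma payoff_vE a p pi :
  payoff_v a p pi = \sum_s signal_prob p pi s * principal_v (a s).
Proof.
rewrite /at_prior /V /signal_prob.
under eq_bigr do rewrite mulr_sumr.
rewrite exchange_big/=; apply: eq_bigr => s _.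
by rewrite mulr_suml; apply: eq_bigr => y _; rewrite mulrA.
Qed.

Lemma payoff_uB a b p pi : payoff_u a p pi - payoff_u b p pi =
  \sum_s \sum_y pi y * p y s * lead (a s) (b s) y.
Proof.
rewrite /at_prior /U -sumrB exchange_big/=; apply: eq_bigr => y _.
rewrite -mulrBr -sumrB mulr_sumr; apply: eq_bigr => s _.
by rewrite -mulrBr mulrA.
Qed.

Definition obey : action I := [ffun s => s].

(** The margin is relative to the probability of the signal: signals that are never sent satisfy it,
    and the condition is linear in the masses [pi y * p y s]. *)
Definition obedient (g : R) p pi : Prop := forall s s', s' != s ->
  g * signal_prob p pi s <= \sum_y pi y * p y s * lead s s' y.

(** Signal by signal: where [a] disobeys, utility falls by at least [g] times the probability of the
    signal, while the value moves by at most that probability. *)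
Lemma obedient_deviation g p pi a : 0 <= g -> obedient g p pi ->
  g * `|payoff_v obey p pi - payoff_v a p pi|
    <= payoff_u obey p pi - payoff_u a p pi.
Proof.
move=> g0 ob; rewrite !payoff_vE payoff_uB -sumrB.
apply: le_trans (_ : g * \sum_s `|signal_prob p pi s * principal_v (obey s) -
   signal_prob p pi s * principal_v (a s)| <= _).
  by rewrite ler_wpM2l// ler_norm_sum.
rewrite mulr_sumr; apply: ler_sum => s _; rewrite ffunE -mulrBr.
have [->|sa] := eqVneq (a s) s.
  rewrite subrr mulr0 normr0 mulr0 big1// => y _.
  by rewrite /lead subrr mulr0.
apply: le_trans (ob _ _ sa); rewrite ler_wpM2l// normrM ger0_norm ?signal_prob_ge0//.
rewrite ler_piMr ?signal_prob_ge0// ler_norml.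
by have := principal_v01 s; have := principal_v01 (a s); lra.
Qed.

(** [astar] may differ from [obey] on signals of probability zero, so only the values are
    compared. *)
Lemma obedient_astar_v (tb : tie_breaking I) g p pi : 0 < g -> obedient g p pi ->
  payoff_v (astar tb p pi) p pi = payoff_v obey p pi.
Proof.
move=> g0 ob; have [/(_ obey) H _] := astarP tb p pi.
have := obedient_deviation (astar tb p pi) (ltW g0) ob.
have : payoff_u obey p pi - payoff_u (astar tb p pi) p pi <= 0 by lra.
move=> h1 /le_trans/(_ h1); rewrite pmulr_rle0// normr_le0 subr_eq0.
by move/eqP.
Qed.

(** By [obedient_deviation], a deviation that costs more than [c >= x] in value costs at least
    [g * x] in utility. *)
Lemma obedient_stable (tb : tie_breaking I) g x c p pi :
  0 < g -> 0 <= x <= c -> obedient g p pi ->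
  stable tb (x * g) c p pi.
Proof.
move=> g0 /andP[x0 xc] ob a _; rewrite (obedient_astar_v tb g0 ob).
have [h|h] := leP (payoff_v obey p pi - c) (payoff_v a p pi); [by right|left].
have [/(_ obey) H _] := astarP tb p pi.
have := obedient_deviation a (ltW g0) ob.
have : g * x <= g * `|payoff_v obey p pi - payoff_v a p pi|.
  rewrite ler_wpM2l ?(ltW g0)//; apply: le_trans (ler_norm _); lra.
rewrite [g * x]mulrC; lra.
Qed.

Lemma obedient_le g g' p pi : g' <= g -> obedient g p pi -> obedient g' p pi.
Proof.
move=> gg ob s s' ss'; apply: le_trans (ob _ _ ss').
by rewrite ler_wpM2r ?signal_prob_ge0.
Qed.

Section Direct.
Variables (p0 : policy I) (a : action I) (pi : belief R).

(** The joint mass of the state and the strategy played when [a] is used against [p0], that is, the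
    direct scheme of the revelation principle before division by the prior. *)
Definition direct_mass y s : R := \sum_(s0 | a s0 == s) pi y * p0 y s0.

Lemma direct_mass_ge0 y s : 0 <= direct_mass y s.
Proof. by rewrite sumr_ge0// => s0 _; rewrite mulr_ge0// dist_ge0. Qed.

Lemma direct_mass_sum y : \sum_s direct_mass y s = pi y.
Proof.
rewrite -[RHS]mulr1 -(dist_sum (p0 y)) mulr_sumr.
by rewrite [RHS](partition_big a xpredT).
Qed.

Lemma direct_mass_v :
  payoff_v a p0 pi = \sum_s (\sum_y direct_mass y s) * principal_v s.
Proof.
rewrite payoff_vE (partition_big a xpredT)//=; apply: eq_bigr => s _.
rewrite exchange_big/= mulr_suml; apply: eq_bigr => s0 /eqP <-.
by [].
Qed.

Lemma direct_mass_u (f : strat I -> strat I) :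
  payoff_u [ffun s => f (a s)] p0 pi - payoff_u a p0 pi =
  \sum_s \sum_y direct_mass y s * lead (f s) s y.
Proof.
rewrite payoff_uB (partition_big a xpredT)//=; apply: eq_bigr => s _.
rewrite exchange_big/=; apply: eq_bigr => y _.
rewrite mulr_suml; apply: eq_bigr => s0 /eqP <-.
by rewrite ffunE.
Qed.

(** [r s] is the gain of the best deviation from [s] alone. All these deviations together form a
    single action against [p0], so their gains add up to at most [eps]. *)
Lemma signal_regrets (eps : R) :
  (forall b, payoff_u b p0 pi <= payoff_u a p0 pi + eps) ->
  exists r : strat I -> R, [/\ forall s, 0 <= r s, \sum_s r s <= eps &
    forall s s', - r s <= \sum_y direct_mass y s * lead s s' y].
Proof.
move=> Ha.
have /choice[f fP] : forall s, exists s1, forall s',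
    \sum_y direct_mass y s * lead s' s y <= \sum_y direct_mass y s * lead s1 s y.
  move=> s; case: (@arg_maxP _ _ _ s xpredT
    (fun s' => \sum_y direct_mass y s * lead s' s y)) => // s1 _ H.
  by exists s1 => s'; exact: H.
exists (fun s => \sum_y direct_mass y s * lead (f s) s y); split.
- move=> s; apply: le_trans (fP s s).
  by rewrite sumr_ge0// => y _; rewrite /lead subrr mulr0.
- by rewrite -direct_mass_u; have := Ha [ffun s => f (a s)]; lra.
- move=> s s'; rewrite lerNl -sumrN; apply: le_trans (fP s s').
  by apply: ler_sum => y _; rewrite (lead_antisym s') mulrN.
Qed.

End Direct.
End Schemes.

(** * Obedient policies competing with a benchmark at one prior *)

Section Robust.
Variables (R : realType) (I : persuasion R) (g : R) (sep : separation I g).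
Implicit Types (s : strat I) (p : policy I) (pi : belief R) (a : action I).

Notation payoff_u a p pi := (at_prior (@U R I) a p pi).
Notation payoff_v a p pi := (at_prior (@V R I) a p pi).

(** Every signal of the direct scheme is trimmed. The masses sum to 1 and the regrets to at most
    [eps], which bounds the removed mass; values lie in [[0, 1]], so no more than this is lost. *)
Lemma robust_policy p0 a pi (eps b : R) : 0 < pi true -> 0 < pi false ->
  0 <= b <= 1 ->
  (forall a', payoff_u a' p0 pi <= payoff_u a p0 pi + eps) ->
  exists2 p, obedient (g ^+ 2 / 4 * b) p pi &
    payoff_v a p0 pi - (b + eps / (g ^+ 2 / 4)) <= payoff_v (obey I) p pi.
Proof.
move=> pi1 pi0 b01 Ha; have /andP[g0 g1] := sep01 sep.
have G0 : 0 < g ^+ 2 / 4 by rewrite divr_gt0// exprn_gt0.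
have Gb : g ^+ 2 / 4 * b <= g.
  have : g ^+ 2 / 4 * b <= g ^+ 2 / 4 * 1 by rewrite ler_wpM2l ?(ltW G0)//; lra.
  have : g ^+ 2 <= g by rewrite expr2 ler_piMr// ltW.
  lra.
have piy y : 0 < pi y by case: y.
have /choice[z zP] : forall y, exists s, best_at y s.
  by move=> y; exact: best_at_exists (policy_strat p0).
have [r [r0 r_sum rP]] := signal_regrets Ha.
set M := direct_mass p0 a pi in rP.
have M0 y s : 0 <= M y s by exact: direct_mass_ge0.
have /choice[m mP] : forall s, exists m : bool -> R,
    [/\ forall y, 0 <= m y <= M y s,
      \sum_y M y s - \sum_y m y <= b * (\sum_y M y s) + r s / (g ^+ 2 / 4) &
      forall s', s' != s -> g ^+ 2 / 4 * b * (\sum_y m y) <=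
        \sum_y m y * lead s s' y].
  move=> s; have [|A' [B' [HA HB Hm H]]] := @trim_signal R I g sep s (z false) (z true)
    (M true s) (M false s) (r s) b (zP _) (zP _) b01 (M0 _ _) (M0 _ _) (r0 _).
    by move=> s' _; have := rP s s'; rewrite big_bool.
  exists (fun y => if y then A' else B'); rewrite !big_bool/=; split=> //.
    by case.
  by move=> s' /H; rewrite big_bool.
pose loss y := pi y - \sum_s m s y.
have loss0 y : 0 <= loss y.
  rewrite subr_ge0 -(direct_mass_sum p0 a pi y).
  by apply: ler_sum => s _; have [/(_ y)/andP[]] := mP s.
(* The mass removed from state [y] is revealed: it goes to [z y], which is best in that state and is
   therefore obeyed there with margin [g], at least the margin required. *)
pose N y s := m s y + (s == z y)%:R * loss y.
have m0 y s : 0 <= m s y by have [/(_ y)/andP[]] := mP s.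
have N0 y s : 0 <= N y s by rewrite addr_ge0// mulr_ge0.
have [||p pE] := @policy_of R I (fun y s => N y s / pi y).
- by move=> y s; rewrite divr_ge0// ltW.
- move=> y; rewrite -mulr_suml big_split/= -mulr_suml.
  have -> : \sum_s (s == z y)%:R = 1 :> R.
    by rewrite (bigD1 (z y))//= eqxx big1 ?addr0// => s /negPf->.
  by rewrite mul1r /loss addrC subrK divff// gt_eqF.
have pN y s : pi y * p y s = N y s by rewrite pE mulrC divfK// gt_eqF.
have qN s : signal_prob p pi s = \sum_y N y s.
  by apply: eq_bigr => y _; rewrite pN.
exists p.
  move=> s s' ss'; rewrite qN; under [leRHS]eq_bigr do rewrite pN.
  rewrite /N big_split/= mulrDr.
  under [leRHS]eq_bigr do rewrite mulrDl.
  rewrite [leRHS]big_split/= lerD//; first by have [_ _ /(_ _ ss')] := mP s.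
  rewrite mulr_sumr; apply: ler_sum => y _.
  rewrite [leLHS]mulrC; have [sz|_] := eqVneq s (z y); last by rewrite !mul0r.
  rewrite mul1r ler_wpM2l//; apply: le_trans Gb _.
  by apply: best_at_lead ss' => //; rewrite sz.
rewrite [leRHS]payoff_vE (direct_mass_v p0) -/M.
have lossE : \sum_s (\sum_y M y s - \sum_y m s y) <= b + eps / (g ^+ 2 / 4).
  apply: le_trans (_ : \sum_s (b * (\sum_y M y s) + r s / (g ^+ 2 / 4)) <= _).
    by apply: ler_sum => s _; have [] := mP s.
  rewrite big_split/= -mulr_sumr exchange_big/=.
  under eq_bigr do rewrite direct_mass_sum.
  rewrite dist_sum mulr1 lerD2l -mulr_suml ler_wpM2r// invr_ge0 ltW//.
rewrite lerBlDr; apply: le_trans (lerD (lexx _) lossE).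
rewrite -big_split/=; apply: ler_sum => s _; rewrite ffunE qN.
have /andP[v0 v1] := principal_v01 s.
have h1 : (\sum_y m s y) * principal_v s <= (\sum_y N y s) * principal_v s.
  by rewrite ler_wpM2r//; apply: ler_sum => y _; rewrite lerDl mulr_ge0.
have h2 : (\sum_y M y s - \sum_y m s y) * principal_v s <=
    \sum_y M y s - \sum_y m s y.
  rewrite ler_piMr// subr_ge0; apply: ler_sum => y _.
  by have [/(_ y)/andP[]] := mP s.
lra.
Qed.

(** The policy always recommends the strategy that is best in the nearly certain state [~~ y].
    Near-optimal play rarely does anything else: by [rare_state_regret], [g / 4] times the mass of
    the other direct signals is at most the mass of [y] plus the total regret. *)
Lemma uninformative_policy y (z : strat I) : best_at (~~ y) z ->
  exists p, forall pi (d : R), pi y <= d -> d <= g / 4 ->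
    obedient (g / 2) p pi /\
    forall p0 a eps,
      (forall a', payoff_u a' p0 pi <= payoff_u a p0 pi + eps) ->
      payoff_v a p0 pi - (d + eps) / (g / 4) <= payoff_v (obey I) p pi.
Proof.
move=> best; have /andP[g0 g1] := sep01 sep.
have [||p pE] := @policy_of R I (fun _ s => (s == z)%:R).
- by move=> _ s; rewrite ler0n.
- by move=> _; rewrite (bigD1 z)//= eqxx big1 ?addr0// => s /negPf->.
exists p => pi d pid dg; have pi1 := belief_sum pi y.
have q s : signal_prob p pi s = (s == z)%:R.
  rewrite /signal_prob; under eq_bigr do rewrite pE.
  by rewrite -mulr_suml dist_sum mul1r.
split.
  move=> s s' ss'; rewrite q; under eq_bigr do rewrite pE.
  have [sz|_] := eqVneq s z; last first.
    by rewrite mulr0 big1// => y' _; rewrite mulr0 mul0r.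
  under eq_bigr do rewrite mulr1.
  rewrite (sum_bool y) mulr1; move: ss'; rewrite sz => ss'.
  have l1 : pi y * -1 <= pi y * lead z s' y.
    by rewrite ler_wpM2l ?dist_ge0//; case/andP: (lead_bounds z s' y).
  have l2 : pi (~~ y) * g <= pi (~~ y) * lead z s' (~~ y).
    by rewrite ler_wpM2l ?dist_ge0// (best_at_lead sep).
  have l3 : pi y * g <= d * 1 by rewrite ler_pM ?dist_ge0 ?(ltW g0).
  have : pi (~~ y) * g = g - pi y * g by rewrite (_ : pi (~~ y) = 1 - pi y); [ring|lra].
  lra.
move=> p0 a eps Ha.
have [r [r0 r_sum rP]] := signal_regrets Ha.
have -> : payoff_v (obey I) p pi = principal_v z.
  rewrite payoff_vE (bigD1 z)//= big1 ?addr0 => [|s /negPf sz].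
    by rewrite q eqxx mul1r ffunE.
  by rewrite q sz mul0r.
rewrite (direct_mass_v p0); set M := direct_mass p0 a pi in rP *.
have M0 y' s : 0 <= M y' s by exact: direct_mass_ge0.
have Msum : \sum_s \sum_y' M y' s = 1.
  rewrite exchange_big/=; under eq_bigr do rewrite direct_mass_sum.
  exact: dist_sum.
have rare : \sum_(s | s != z) \sum_y' M y' s <= (d + eps) / (g / 4).
  rewrite ler_pdivlMr ?divr_gt0// mulr_suml.
  apply: le_trans (_ : \sum_s (M y s + r s) <= _); last first.
    by rewrite big_split/= direct_mass_sum lerD.
  rewrite [leRHS](bigD1 z)//= -[leLHS]add0r lerD ?addr_ge0//.
  apply: ler_sum => s sz; rewrite [leLHS]mulrC (sum_bool y).
  have [|||h|h] := @rare_state_regret R I g sep y s z (M y s) (M (~~ y) s) (r s) best sz.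
  - exact: M0.
  - exact: M0.
  - by move=> s' _; have := rP s s'; rewrite (sum_bool y).
  - by apply: le_trans h _; rewrite lerDl.
  - by apply: le_trans h _; rewrite lerDr.
rewrite lerBlDr; apply: le_trans (lerD (lexx _) rare).
rewrite (bigD1 z)//= lerD//.
  rewrite ler_piMl//; first by case/andP: (principal_v01 z).
  rewrite -Msum (bigD1 z)//= lerDl sumr_ge0// => s _.
  by rewrite sumr_ge0.
apply: ler_sum => s _; rewrite ler_piMr ?sumr_ge0//.
by case/andP: (principal_v01 s).
Qed.

End Robust.

(** * The oracle *)

Section Prior.
Variables (R : realType) (I : persuasion R).
Implicit Types (s : strat I) (p : policy I) (pi : belief R) (a : action I).

Lemma U01 a p y : 0 <= U a p y <= 1.
Proof.
rewrite sumr_ge0/= => [|s _]; last first.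
  by rewrite mulr_ge0 ?dist_ge0//; case/andP: (agent_u01 (a s) y).
rewrite -(dist_sum (p y)); apply: ler_sum => s _.
by rewrite ler_piMr ?dist_ge0//; case/andP: (agent_u01 (a s) y).
Qed.

Lemma V01 a p y : 0 <= V a p y <= 1.
Proof.
rewrite sumr_ge0/= => [|s _]; last first.
  by rewrite mulr_ge0 ?dist_ge0//; case/andP: (principal_v01 (a s)).
rewrite -(dist_sum (p y)); apply: ler_sum => s _.
by rewrite ler_piMr ?dist_ge0//; case/andP: (principal_v01 (a s)).
Qed.

(** With two states the expectation is affine in [pi true], and its slope is a difference of two
    numbers of [[0, 1]]. *)
Lemma at_prior_change (W : action I -> policy I -> bool -> R) a p pi pi' :
  (forall a p y, 0 <= W a p y <= 1) ->
  at_prior W a p pi <= at_prior W a p pi' + `|pi true - pi' true|.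
Proof.
move=> W01; rewrite /at_prior !big_bool/= -lerBlDl.
have E (q : belief R) : q false = 1 - q true by have := belief_sum q true => /= <-; ring.
rewrite !E; apply: le_trans (_ : `|pi true - pi' true| * `|W a p true - W a p false| <= _).
  rewrite -normrM; apply: le_trans (ler_norm _); rewrite le_eqVlt; apply/orP; left.
  by apply/eqP; ring.
rewrite ler_piMr// ler_norml.
by have := W01 a p true; have := W01 a p false; lra.
Qed.

(** Leads are at most 1 in absolute value, so the change of prior costs at most [d] of the margin;
    the factor 1/2 pays for the probability of the signal, which at most doubles. *)
Lemma obedient_prior_change (c d : R) p pi pi' :
  0 <= d <= 1 -> d <= c -> (forall y, `|pi' y - pi y| <= d * pi y) ->
  obedient c p pi -> obedient ((c - d) / 2) p pi'.
Proof.
move=> /andP[d0 d1] dc Hpi ob s s' ss'.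
have q2 : signal_prob p pi' s <= 2 * signal_prob p pi s.
  rewrite /signal_prob mulr_sumr; apply: ler_sum => y _.
  rewrite mulrA ler_wpM2r ?dist_ge0//.
  have := Hpi y; rewrite ler_norml => /andP[_].
  have : d * pi y <= 1 * pi y by rewrite ler_wpM2r ?dist_ge0.
  lra.
have : (c - d) / 2 * signal_prob p pi' s <= (c - d) / 2 * (2 * signal_prob p pi s).
  by rewrite ler_wpM2l// divr_ge0// subr_ge0.
move/le_trans; apply.
have -> : (c - d) / 2 * (2 * signal_prob p pi s) =
  c * signal_prob p pi s - d * signal_prob p pi s by field.
rewrite lerBlDr; apply: le_trans (ob _ _ ss') _.
rewrite /signal_prob mulr_sumr -big_split/=; apply: ler_sum => y _.
rewrite -lerBlDl -mulrBl -mulrBl.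
apply: le_trans (ler_norm _) _; rewrite normrM [d * _]mulrA normrM.
apply: le_trans (_ : `|pi y - pi' y| * `|p y s| <= _).
  by rewrite ler_piMr ?mulr_ge0// ler_norml lead_bounds.
rewrite (ger0_norm (dist_ge0 _ _)) ler_wpM2r ?dist_ge0//.
by rewrite distrC Hpi.
Qed.

End Prior.

Section Oracle.
Variables (R : realType) (I : persuasion R) (g : R) (sep : separation I g).
Variables (P0 : {fset policy I}) (tb : tie_breaking I) (P0n0 : P0 != fset0).
Implicit Types (s : strat I) (p : policy I) (pi : belief R) (a : action I).

Notation payoff_u a p pi := (at_prior (@U R I) a p pi).
Notation payoff_v a p pi := (at_prior (@V R I) a p pi).

Definition near_optimal (eps c err : R) p pi : Prop :=
  obedient c p pi /\ forall p0, p0 \in P0 ->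
    payoff_v (astar_eps tb p0 pi eps) p0 pi - err <= payoff_v (obey I) p pi.

Lemma astar_eps_regret p pi eps a : 0 <= eps ->
  payoff_u a p pi <= payoff_u (astar_eps tb p pi eps) p pi + eps.
Proof.
move=> eps0; have [/(_ a) H _] := astarP tb p pi.
have [/= H1 _] := astar_epsP tb p pi eps0.
by lra.
Qed.

Section PriorGrid.
Variables (b eps d : R).
Hypothesis adm : [/\ 0 <= b, b < g ^+ 2 / 16, 0 <= eps, 0 < d & d <= b ^+ 2 / 16].

(** In terms of the constants of the theorem, [c] is [c1 * b / 2] and [err] is
    [3 * b / C + c2 * eps]. *)
Local Notation c := (g ^+ 2 / 16 * b).
Local Notation err := (12 / g ^+ 2 * b + 4 / g ^+ 2 * eps).

Local Lemma g_gt0 : 0 < g. Proof. by case/andP: (sep01 sep). Qed.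
Local Lemma g2_gt0 : 0 < g ^+ 2. Proof. by rewrite exprn_gt0// g_gt0. Qed.
Local Lemma g2_le : g ^+ 2 <= g.
Proof. by have /andP[_ g1] := sep01 sep; rewrite expr2 ler_piMr// ltW// g_gt0. Qed.
Local Lemma g_le1 : g <= 1. Proof. by case/andP: (sep01 sep). Qed.
Local Lemma b_le : b <= 1 / 16.
Proof. by have [b0 bC eps0 d0 db] := adm; have := g2_le; have := g_le1; lra. Qed.
Local Lemma d_le : d <= b / 16.
Proof.
have [b0 bC eps0 d0 db] := adm.
have : b * b <= 1 * b by rewrite ler_wpM2r//; have := b_le; lra.
by rewrite -expr2; lra.
Qed.
Local Lemma gV : 4 <= 4 / g ^+ 2.
Proof. by rewrite ler_pdivlMr ?g2_gt0//; have := g2_le; have := g_le1; lra. Qed.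
Local Lemma db2 : 2 * d <= g ^+ 2 / 8 * b.
Proof.
have [b0 bC eps0 d0 db] := adm.
have : b * b <= g ^+ 2 / 16 * b by rewrite ler_wpM2r// ltW.
by rewrite -expr2; lra.
Qed.

Lemma extreme_prior_policy y :
  exists p, forall pi, pi y <= d -> near_optimal eps c err p pi.
Proof.
have [b0 bC eps0 d0 db] := adm.
case/fset0Pn: (P0n0) => q _; have [z best] := best_at_exists (~~ y) (policy_strat q).
have [p H] := uninformative_policy sep best; exists p => pi pid.
have := H pi d pid; case.
  by have := d_le; have := g_le1; have := g2_le; lra.
move=> ob Hp; split.
  apply: obedient_le ob.
  have : g ^+ 2 / 16 * b <= g ^+ 2 / 16 * 1.
    by rewrite ler_wpM2l ?(ltW g2_gt0) ?divr_ge0//; have := b_le; lra.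
  by have := g2_le; lra.
move=> p0 p0P; apply: le_trans (Hp p0 (astar_eps tb p0 pi eps) eps _); last first.
  by move=> a'; exact: astar_eps_regret.
rewrite lerD2l lerN2.
have : (d + eps) / (g / 4) <= (b + eps) * (4 / g ^+ 2).
  apply: ler_pM; rewrite ?addr_ge0 ?invr_ge0 ?divr_ge0// ?(ltW g_gt0) ?(ltW d0)//.
    by rewrite lerD2r; have := d_le; lra.
  by rewrite invf_div ler_wpM2l// lef_pV2 ?posrE ?g2_gt0 ?g_gt0 ?g2_le.
have : 0 <= 4 / g ^+ 2 * b by rewrite mulr_ge0// divr_ge0// (ltW g2_gt0).
lra.
Qed.

Lemma interior_prior_policy pi : 0 < pi true -> 0 < pi false ->
  exists p, forall pi', `|pi' true - pi true| <= d ^+ 2 ->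
    (forall y, `|pi' y - pi y| <= 2 * d * pi y) -> near_optimal eps c err p pi'.
Proof.
have [b0 bC eps0 d0 db] := adm.
(* Between [pi'] and [pi] the utilities of two compared actions move by at most [d^2] each, so an
   [eps]-best response at [pi'] is an [e]-best response at [pi]. A policy built at [pi] for the
   tolerance [e] thus serves all the nearby priors. *)
move=> pi1 pi2; set e := eps + 2 * d ^+ 2.
have e0 : 0 <= e by rewrite addr_ge0// mulr_ge0// exprn_ge0 ?ltW.
have [q0 q0P] : exists q0, forall p0, p0 \in P0 ->
    payoff_v (astar_eps tb p0 pi e) p0 pi <= payoff_v (astar_eps tb q0 pi e) q0 pi.
  case/fset0Pn: P0n0 => p1 p1P.
  case: (@arg_maxP _ _ P0 [` p1P]%fset xpredT
    (fun q => payoff_v (astar_eps tb (val q) pi e) (val q) pi)) => // q0 _ H.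
  by exists (val q0) => p0 p0P; have := H [` p0P]%fset isT.
have [||p ob Hp] := @robust_policy R I g sep q0 (astar_eps tb q0 pi e) pi e b pi1 pi2.
- by have := b_le; lra.
- by move=> a'; exact: astar_eps_regret.
exists p => pi' Hpi' Hy; split.
  (* The margin [g^2 / 4 * b] loses [2 * d], which is at most [g^2 / 8 * b], and is then halved;
     [g^2 / 16 * b] remains. *)
  have Hd := db2.
  have bg : 0 <= g ^+ 2 * b by rewrite mulr_ge0// ltW ?g2_gt0.
  apply: (@obedient_le _ _ ((g ^+ 2 / 4 * b - 2 * d) / 2)); first by lra.
  apply: obedient_prior_change Hy ob; last by lra.
  by have := d_le; have := b_le; lra.
move=> p0 p0P; set a := astar_eps tb p0 pi' eps.
have h1 := @at_prior_change R I (@V R I) a p0 pi' pi (@V01 R I).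
have h2 : payoff_v a p0 pi <= payoff_v (astar_eps tb p0 pi e) p0 pi.
  have [_ /= H] := astar_epsP tb p0 pi e0; apply: H.
  have := astar_eps_regret p0 pi' (astar tb p0 pi) eps0.
  have := @at_prior_change R I (@U R I) (astar tb p0 pi) p0 pi pi' (@U01 R I).
  have := @at_prior_change R I (@U R I) a p0 pi' pi (@U01 R I).
  have : `|pi true - pi' true| <= d ^+ 2 by rewrite distrC.
  by rewrite /e -/a; lra.
have h3 := q0P _ p0P.
have h4 := @at_prior_change R I (@V R I) (obey I) p pi pi' (@V01 R I).
rewrite distrC in h4.
have h5 : d ^+ 2 <= d by rewrite expr2 ler_piMr ?(ltW d0)//; have := d_le; have := b_le; lra.
have h6 : e / (g ^+ 2 / 4) = 4 / g ^+ 2 * e by rewrite invf_div mulrC.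
have h7 : 4 / g ^+ 2 * e <= 4 / g ^+ 2 * (eps + b / 8).
  by rewrite ler_wpM2l ?divr_ge0 ?(ltW g2_gt0)// /e; have := d_le; lra.
have h8 : 4 * b <= 4 / g ^+ 2 * b by rewrite ler_wpM2r ?gV.
rewrite h6 in Hp; have := d_le; lra.
Qed.

(* The grid of priors has mesh d^2, so that prior probabilities of states,
   which are at least d away from the extreme cells, vary by a factor at most
   1 +- 2 d within one cell. *)
Definition prior_cell pi : nat :=
  if pi true < d then 0 else if pi false < d then 1
  else (Num.truncn (pi true / d ^+ 2)).+2.

Lemma cell_policies :
  exists Q : nat -> policy I, forall pi, near_optimal eps c err (Q (prior_cell pi)) pi.
Proof.
have [b0 bC eps0 d0 db] := adm.
suff /choice[Q QP] : forall k, exists p, forall pi, prior_cell pi = k ->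
    near_optimal eps c err p pi by exists Q => pi; exact: QP.
move=> k; case: (pselect (exists pi, prior_cell pi = k)) => [[pi1 pi1k]|nex]; last first.
  by case/fset0Pn: P0n0 => p _; exists p => pi pik; exfalso; apply: nex; exists pi.
have [p0 p0P] := extreme_prior_policy true; have [p1 p1P] := extreme_prior_policy false.
case: k pi1k => [|[|k]] pi1k.
- exists p0 => pi; rewrite /prior_cell; case: ltP => [/ltW h _|_]; first exact: p0P.
  by case: ifP.
- exists p1 => pi; rewrite /prior_cell; case: ltP => // _.
  by case: ltP => // /ltW h _; exact: p1P.
have d2 : 0 < d ^+ 2 by exact: exprn_gt0.
have dd : d ^+ 2 <= d / 2.
  have : d * d <= 1 / 2 * d by rewrite ler_wpM2r ?(ltW d0)//; have := d_le; have := b_le; lra.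
  by rewrite -expr2; lra.
have cellP pi : prior_cell pi = k.+2 -> [/\ d <= pi true, d <= pi false,
    k%:R * d ^+ 2 <= pi true & pi true < k%:R * d ^+ 2 + d ^+ 2].
  rewrite /prior_cell; case: ltP => // h1; case: ltP => // h2 [kE]; split=> //.
    rewrite -ler_pdivlMr// -kE truncn_le// divr_ge0 ?dist_ge0// ltW//.
  have := truncnS_gt (pi true / d ^+ 2); rewrite kE ltr_pdivrMr//.
  by rewrite -addn1 natrD mulrDl mul1r.
have [m1 m2 m3 m4] := cellP _ pi1k.
have s1 := belief_sum pi1 true; rewrite /= in s1.
(* The representative is the left end [k * d^2], which may lie outside the cell. Both states still
   have probability at least [d / 2] there, so [d^2] is at most [2 * d] times either probability. *)
have [|pik [pikt pikf]] := @belief_of R (k%:R * d ^+ 2).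
  by rewrite mulr_ge0 ?(ltW d2)//=; have := dist_ge0 pi1 false; lra.
have [||p pP] := @interior_prior_policy pik.
- by rewrite pikt; lra.
- by rewrite pikf; lra.
exists p => pi /cellP[n1 n2 n3 n4].
have s2 := belief_sum pi true; rewrite /= in s2.
have h1 : `|pi true - pik true| <= d ^+ 2 by rewrite ler_norml pikt; lra.
have h2 : d * (d / 2) <= d * pik true by rewrite ler_wpM2l ?(ltW d0)// pikt; lra.
have h3 : d * d <= d * pik false by rewrite ler_wpM2l ?(ltW d0)// pikf; lra.
rewrite expr2 in h1.
apply: pP; first by rewrite expr2.
have h4 : 0 <= d * d by rewrite mulr_ge0 ?ltW.
case; first by lra.
apply: le_trans (_ : d * d <= _); last by lra.
have -> : pi false - pik false = - (pi true - pik true) by rewrite pikf pikt; lra.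
by rewrite normrN.
Qed.

Lemma prior_cell_lt pi : (prior_cell pi < (Num.truncn (d ^- 2)).+3)%N.
Proof.
have [b0 bC eps0 d0 db] := adm.
rewrite /prior_cell; case: ifP => // _; case: ifP => // _.
rewrite !ltnS le_truncn// -[leRHS]mul1r ler_wpM2r ?dist_le1//.
by rewrite invr_ge0 exprn_ge0 ?ltW.
Qed.

End PriorGrid.
End Oracle.

Lemma card_fset_set_le (X : choiceType) (A : set X) (s : seq X) :
  (A `<=` [set x | x \in s]) -> finite_set A /\ (#|` fset_set A| <= size s)%N.
Proof.
move=> sub; have fin : finite_set A.
  by apply: sub_finite_set sub _; exact: finite_seq.
split=> //; apply: leq_trans (_ : #|` [fset x in s]%fset| <= _)%N.
  apply: fsubset_leq_card; apply/fsubsetP => p.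
  by rewrite in_fset_set// => /set_mem/sub ps; rewrite inE.
by rewrite card_fseq size_undup.
Qed.

Lemma n_outputs_le (R : realType) (I : persuasion R) (o : belief R -> policy I)
    (Q : nat -> policy I) (k : belief R -> nat) (n : nat) :
  (forall pi, o pi = Q (k pi)) -> (forall pi, (k pi < n)%N) ->
  finite_set (outputs o) /\ (n_outputs o <= n)%N.
Proof.
move=> oQ kn; rewrite -[n in (_ <= n)%N](size_iota 0) -(size_map Q).
apply: card_fset_set_le => _ [pi _ <-]/=.
by rewrite oQ map_f// mem_iota leq0n add0n kn.
Qed.

Lemma oracle_exists (R : realType) (I : persuasion R) (g : R)
    (P0 : {fset policy I}) (tb : tie_breaking I) :
  separation I g -> P0 != fset0 ->
  exists pdelta : R -> R -> R -> R -> belief R -> policy I,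
  forall beta eps x delta : R,
    0 <= beta < g ^+ 2 / 4 / 4 -> 0 <= eps <= 1 -> 0 <= x <= 1 ->
    0 < delta -> delta <= beta ^+ 2 / 16 ->
    let o := pdelta beta eps x delta in
    [/\ optimal_stable_oracle tb P0
          (3 * beta / (g ^+ 2 / 4) + 4 / g ^+ 2 * Num.sqrt eps + 2 * Num.sqrt delta)
          eps (x * (g ^+ 2 / 8) * beta / 2) (Num.max x (Num.sqrt delta)) o,
        finite_set (outputs o) &
        (n_outputs o)%:R <= 4 * (#|` strat I |%:R ^+ 2 / delta ^+ 2)].
Proof.
move=> sep P0n0; have /andP[g0 g1] := sep01 sep.
have g2 : 0 < g ^+ 2 by exact: exprn_gt0.
have g2_1 : g ^+ 2 <= 1 by exact: exprn_ile1 (ltW g0) g1.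
(* The choice is made over all parameter triples at once and is arbitrary on inadmissible ones, so
   that a single family serves all parameters. *)
pose good (t : R * R * R) (Q : nat -> policy I) :=
  let: (b, eps, d) := t in
  [/\ 0 <= b, b < g ^+ 2 / 16, 0 <= eps, 0 < d & d <= b ^+ 2 / 16] ->
  forall pi, near_optimal P0 tb eps (g ^+ 2 / 16 * b)
    (12 / g ^+ 2 * b + 4 / g ^+ 2 * eps) (Q (prior_cell d pi)) pi.
have /choice[Q QP] : forall t, exists Q, good t Q.
  move=> [[b eps] d].
  case: (pselect [/\ 0 <= b, b < g ^+ 2 / 16, 0 <= eps, 0 < d & d <= b ^+ 2 / 16]).
    by move=> adm; have [Q HQ] := cell_policies sep tb P0n0 adm; exists Q.
  by move=> nadm; case/fset0Pn: P0n0 => p _; exists (fun=> p) => /nadm.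
exists (fun beta eps _ delta pi => Q (beta, eps, delta) (prior_cell delta pi)).
move=> b eps x d /andP[b0 bC] /andP[eps0 eps1] /andP[x0 x1] d0 db o.
have adm : [/\ 0 <= b, b < g ^+ 2 / 16, 0 <= eps, 0 < d & d <= b ^+ 2 / 16].
  by split=> //; move: bC; rewrite -mulrA -invfM -natrM.
have b_gt0 : 0 < b.
  rewrite lt0r b0 andbT; apply/eqP => b_eq0; move: db.
  by rewrite b_eq0 expr0n mul0r leNgt d0.
have d1 : d <= 1.
  have : b ^+ 2 <= 1 by apply: exprn_ile1 => //; lra.
  lra.
have [fin le_n] := @n_outputs_le R I o (Q (b, eps, d)) (prior_cell d)
  (Num.truncn (d ^- 2)).+3 (fun=> erefl) (prior_cell_lt adm).
split=> //.
  move=> pi; have [ob opt] := QP (b, eps, d) adm pi.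
  have c0 : 0 < g ^+ 2 / 16 * b by rewrite mulr_gt0// divr_gt0.
  split.
    have -> : x * (g ^+ 2 / 8) * b / 2 = x * (g ^+ 2 / 16 * b) by field.
    by apply: obedient_stable => //; rewrite x0 le_max lexx.
  move=> p0 /opt; rewrite (obedient_astar_v tb c0 ob); apply: le_trans.
  rewrite lerD2l lerN2.
  have -> : 3 * b / (g ^+ 2 / 4) = 12 / g ^+ 2 * b by field; rewrite gt_eqF.
  have : 4 / g ^+ 2 * eps <= 4 / g ^+ 2 * Num.sqrt eps.
    rewrite ler_wpM2l ?divr_ge0 ?(ltW g2)//.
    rewrite -{1}(sqr_sqrtr eps0) expr2 ler_piMr ?sqrtr_ge0//.
    by rewrite -[leRHS]sqrtr1 ler_sqrt.
  have := sqrtr_ge0 d; lra.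
have S1 : 1 <= #|` strat I |%:R :> R.
  case/fset0Pn: P0n0 => p _; rewrite (_ : 1 = 1%:R)// ler_nat cardfs_gt0.
  by apply/fset0Pn; exists (val (policy_strat p)); exact: valP.
(* The summand 3 in the number of cells is at most [3 * d ^- 2], whence the factor 4; the factor
   [n^2 >= 1] is inserted afterwards. *)
have dV : 1 <= d ^- 2 by rewrite invf_ge1 ?exprn_gt0// exprn_ile1// ltW.
apply: le_trans (_ : (Num.truncn (d ^- 2)).+3%:R <= _); first by rewrite ler_nat.
have : (Num.truncn (d ^- 2))%:R <= d ^- 2 by rewrite truncn_le// (le_trans ler01).
have : 1 * d ^- 2 <= #|` strat I |%:R ^+ 2 * d ^- 2.
  by rewrite ler_wpM2r ?(le_trans ler01)// expr_ge1// (le_trans ler01).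
rewrite -(addn3 (Num.truncn (d ^- 2))) natrD; lra.
Qed.

(** * Regret for fixed forecasts *)

(** Induction on [T]: the first action is split off, and the remaining kernels see it prepended to
    their history. *)
Lemma sequential_law_mass (R : realType) (A : finType) (T : nat)
    (k : nat -> seq A -> dist R A) :
  \sum_(a : T.-tuple A) \prod_(t < T) k t (take t a) (tnth a t) = 1.
Proof.
elim: T k => [|T IH] k.
  rewrite (bigD1 [tuple])//= big_ord0 big1 ?addr0// => a.
  by case/negP; apply/eqP; exact: tuple0.
rewrite (reindex (fun u : A * T.-tuple A => [tuple of u.1 :: u.2]))/=; last first.
  exists (fun a => (thead a, [tuple of behead a])) => [[x a] _|a _]/=.
    by congr pair; apply: val_inj.
  by rewrite [RHS]tuple_eta.
rewrite -(pair_bigA _ (fun (x : A) (a : T.-tuple A) => \prod_(t < T.+1)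
  k t (take t [tuple of x :: a]) (tnth [tuple of x :: a] t)))/=.
rewrite -[RHS](dist_sum (k 0 [::])); apply: eq_bigr => x _.
transitivity (\sum_(a : T.-tuple A) k 0 [::] x *
    \prod_(t < T) k t.+1 (x :: take t a) (tnth a t)).
  apply: eq_bigr => a _; rewrite big_ord_recl/= (tnth_nth x)/=.
  congr (_ * _); apply: eq_bigr => t _.
  by rewrite (tnth_nth x) [in RHS](tnth_nth x).
by rewrite -mulr_sumr (IH (fun t h => k t.+1 (x :: h))) mulr1.
Qed.

Section Expectation.
Variables (R : realType) (I : persuasion R) (tb : tie_breaking I) (L : learner I).
Variables (psi : belief R -> policy I) (T : nat).
Variables (pi : T.-tuple (belief R)) (y : T.-tuple bool).
Implicit Types f h : T.-tuple (action I) -> R.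

Notation E := (E_play tb L psi pi y).

Lemma E_play_le f h : (forall a, f a <= h a) -> E f <= E h.
Proof.
move=> fh; apply: ler_sum => a _; rewrite ler_wpM2l//.
by rewrite prodr_ge0// => t _; exact: dist_ge0.
Qed.

Lemma eq_E_play f h : (forall a, f a = h a) -> E f = E h.
Proof. by move=> fh; apply: eq_bigr => a _; rewrite fh. Qed.

Lemma E_playZ c f : E (fun a => c * f a) = c * E f.
Proof. by rewrite /E_play /E_actions mulr_sumr; apply: eq_bigr => a _; ring. Qed.

Lemma E_playD f h : E (fun a => f a + h a) = E f + E h.
Proof. by rewrite /E_play /E_actions -big_split; apply: eq_bigr => a _ /=; ring. Qed.

Lemma E_playB f h : E (fun a => f a - h a) = E f - E h.
Proof. by rewrite /E_play /E_actions -sumrB; apply: eq_bigr => a _ /=; ring. Qed.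

Lemma E_play_sum (J : finType) (f : J -> T.-tuple (action I) -> R) :
  E (fun a => \sum_j f j a) = \sum_j E (f j).
Proof.
rewrite /E_play /E_actions exchange_big/=; apply: eq_bigr => a _.
by rewrite mulr_sumr.
Qed.

Lemma E_play_cst c : E (fun=> c) = c.
Proof.
rewrite /E_play /E_actions -mulr_suml -[RHS]mul1r; congr (_ * _).
exact: (sequential_law_mass T (fun t past => L (take t y) past
  (take t.+1 (play_recs tb psi pi)) (take t.+1 (play_policies psi pi)))).
Qed.

Lemma E_play_norm f : `|E f| <= E (fun a => `|f a|).
Proof.
apply: le_trans (ler_norm_sum _ _ _) _; apply: ler_sum => a _.
by rewrite normrM ger0_norm// prodr_ge0// => t _; exact: dist_ge0.
Qed.

End Expectation.

Lemma sum_sqrt_le (R : realType) (X : finType) (f : X -> R) :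
  (forall x, 0 <= f x) ->
  \sum_x Num.sqrt (f x) <= Num.sqrt (#|X|%:R * \sum_x f x).
Proof.
move=> f0; set s := \sum_x f x; set N := #|X|%:R.
have s0 : 0 <= s by exact: sumr_ge0.
have [s_eq0|s_neq0] := eqVneq s 0.
  rewrite big1 ?sqrtr_ge0// => x _; apply/eqP; rewrite sqrtr_eq0.
  by rewrite -s_eq0 /s (bigD1 x)//= lerDl sumr_ge0.
have X0 : (0 < #|X|)%N.
  rewrite lt0n; apply: contra_neq s_neq0 => X0.
  by rewrite /s big1// => x _; have := fintype0 x X0.
have N0 : 0 < N by rewrite ltr0n.
have sg : 0 < s by rewrite lt0r s_neq0.
have r0 : 0 < Num.sqrt (N * s) by rewrite sqrtr_gt0 mulr_gt0.
(* AM-GM: [2 sqrt(f x) l <= f x + l^2] with [l = sqrt(N s) / N] *)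
set l := Num.sqrt (N * s) / N.
have l0 : 0 < l by rewrite divr_gt0.
have ll : N * l ^+ 2 = s.
  by rewrite /l expr_div_n sqr_sqrtr ?mulr_ge0 ?ltW//; field; rewrite gt_eqF.
rewrite -(ler_pM2l (mulr_gt0 (ltr0n R 2) l0)) mulr_sumr.
apply: le_trans (_ : \sum_x (f x + l ^+ 2) <= _).
  apply: ler_sum => x _; rewrite -{2}(sqr_sqrtr (f0 x)) -subr_ge0.
  have -> : forall q : R, q ^+ 2 + l ^+ 2 - 2%:R * l * q = (q - l) ^+ 2 by move=> q; ring.
  exact: sqr_ge0.
rewrite big_split/= -/s (_ : \sum_(x : X) l ^+ 2 = s); last by rewrite sumr_const -ll mulr_natl.
rewrite /l -mulrA mulrAC -expr2 sqr_sqrtr ?(mulr_ge0 (ltW N0))//.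
by rewrite [N * s]mulrC mulfK ?gt_eqF// mulr_natl mulr2n.
Qed.

Lemma bias_ge0 (R : realType) (T : nat) (D : belief R -> bool)
  (pi : T.-tuple (belief R)) (y : T.-tuple bool) : 0 <= bias D pi y.
Proof. by rewrite /bias mulr_ge0 ?invr_ge0// sumr_ge0. Qed.

(** Expanding [f] in the indicators of the two states turns the sum into a combination, with weights
    [f z] in [[0, 1]], of the coordinates whose absolute values make up the bias. *)
Lemma bias_gap (R : realType) (T : nat) (pi : T.-tuple (belief R))
    (y : T.-tuple bool) (D : belief R -> bool) (f : bool -> R) :
  (0 < T)%N -> (forall z, 0 <= f z <= 1) ->
  `|\sum_(t < T | D (tnth pi t)) (\sum_z tnth pi t z * f z - f (tnth y t))|
    <= T%:R * bias D pi y.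
Proof.
move=> T0 f01; rewrite /bias mulrA divff ?mul1r; last by rewrite pnatr_eq0 -lt0n.
have -> : \sum_(t < T | D (tnth pi t)) (\sum_z tnth pi t z * f z - f (tnth y t)) =
    \sum_z f z * \sum_(t < T) (D (tnth pi t))%:R * (tnth pi t z - (tnth y t == z)%:R).
  under [RHS]eq_bigr do rewrite mulr_sumr.
  rewrite exchange_big/= big_mkcond/=; apply: eq_bigr => t _.
  case: (D _); last by rewrite big1// => z _; rewrite mul0r mulr0.
  have -> : f (tnth y t) = \sum_z (tnth y t == z)%:R * f z.
    rewrite (bigD1 (tnth y t))//= eqxx mul1r big1 ?addr0// => z /negPf zy.
    by rewrite eq_sym zy mul0r.
  by rewrite -sumrB; apply: eq_bigr => z _; rewrite mul1r mulrBr ![f z * _]mulrC.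
apply: le_trans (ler_norm_sum _ _ _) _; apply: ler_sum => z _.
by rewrite normrM ler_piMl// ger0_norm; case/andP: (f01 z).
Qed.

Section Mixed.
Variables (R : realType) (I : persuasion R).
Variable W : action I -> policy I -> bool -> R.
Hypothesis W01 : forall a p y, 0 <= W a p y <= 1.

Definition mixed_prior (mu : action I -> R) (p : policy I) (pi : belief R) : R :=
  \sum_b mu b * at_prior W b p pi.

Lemma mixed_priorE mu p pi :
  mixed_prior mu p pi = \sum_z pi z * at_mixed W mu p z.
Proof.
rewrite /mixed_prior /at_prior /at_mixed.
under eq_bigr do rewrite mulr_sumr.
rewrite exchange_big/=; apply: eq_bigr => z _; rewrite mulr_sumr.
by apply: eq_bigr => b _; ring.
Qed.

Lemma at_mixed01 mu p y : (forall b, 0 <= mu b) -> \sum_b mu b = 1 ->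
  0 <= at_mixed W mu p y <= 1.
Proof.
move=> mu0 mu1; apply/andP; split.
  by rewrite sumr_ge0// => b _; rewrite mulr_ge0//; case/andP: (W01 b p y).
rewrite -mu1; apply: ler_sum => b _.
by rewrite ler_piMr//; case/andP: (W01 b p y).
Qed.

End Mixed.

Section Empirical.
Variables (R : realType) (I : persuasion R) (T : nat).
Variables (J : {set 'I_T}) (a : T.-tuple (action I)).

Lemma empirical_ge0 b : 0 <= empirical J a b.
Proof. by rewrite mulr_ge0// sumr_ge0// => t _; exact: ler0n. Qed.

Lemma empirical_sum : (0 < #|J|)%N -> \sum_b empirical J a b = 1.
Proof.
move=> J0; rewrite -mulr_sumr exchange_big/=.
rewrite (eq_bigr (fun=> 1)) => [|t _].
  by rewrite sumr_const mulVf// pnatr_eq0 -lt0n.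
by rewrite (bigD1 (tnth a t))//= eqxx big1 ?addr0// => b /negPf; rewrite eq_sym => ->.
Qed.

End Empirical.

(** * From realized payoffs to payoffs at the forecasts *)

Section Play.
Variables (R : realType) (I : persuasion R) (tb : tie_breaking I) (L : learner I).
Variables (psi : belief R -> policy I) (T : nat).
Variables (pi : T.-tuple (belief R)) (y : T.-tuple bool).
Variables (O : {fset policy I}) (K : R).
Hypotheses (T_gt0 : (0 < T)%N) (psiO : forall m, psi m \in O) (K0 : 0 <= K).
Hypothesis nsi : no_secret_info_play tb L psi pi y K.

Notation E := (E_play tb L psi pi y).

(** Confining the policies to a finite [O] makes the cells a finite type. [O] is the set of oracle
    outputs for the mechanism and a singleton for a constant mechanism. *)
Definition cell_event (x : O * action I) (m : belief R) : bool :=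
  (psi m, astar tb (psi m) m) == (val x.1, x.2).

Definition cell (x : O * action I) : {set 'I_T} :=
  [set t | cell_event x (tnth pi t)]%SET.

Definition cell_of (t : 'I_T) : O * action I :=
  ([` psiO (tnth pi t)]%fset, astar tb (psi (tnth pi t)) (tnth pi t)).

Lemma in_cell t x : (t \in cell x) = (cell_of t == x).
Proof. by rewrite inE /cell_event /cell_of; case: x. Qed.

Lemma sum_cells (F : 'I_T -> R) : \sum_t F t = \sum_x \sum_(t in cell x) F t.
Proof.
rewrite (partition_big cell_of xpredT)//=; apply: eq_bigr => x _.
by apply: eq_bigl => t; rewrite in_cell.
Qed.

Lemma cell_card_sum : \sum_x #|cell x|%:R = T%:R :> R.
Proof.
rewrite -[in RHS](card_ord T) -sumr_const sum_cells.
by apply: eq_bigr => x _; rewrite sumr_const.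
Qed.

Definition play_mix (a : T.-tuple (action I)) (t : 'I_T) : action I -> R :=
  empirical (cell (cell_of t)) a.

Definition estimate_error : R :=
  K * Num.sqrt (#|{: O * action I}|%:R * T%:R) +
  T%:R * \sum_x bias (cell_event x) pi y.

(** Two replacements within each cell: No Secret Information turns the played actions into their
    empirical mix, then the conditional bias turns the realized states into the forecasts. *)
Lemma play_estimate (W : action I -> policy I -> bool -> R) :
  (W = @U R I \/ W = @V R I) ->
  `|E (fun a => \sum_t W (tnth a t) (psi (tnth pi t)) (tnth y t)) -
    E (fun a => \sum_t mixed_prior W (play_mix a t) (psi (tnth pi t)) (tnth pi t))|
  <= estimate_error.
Proof.
move=> WUV; have W01 b p z : 0 <= W b p z <= 1.
  by case: WUV => ->; [exact: U01|exact: V01].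
pose gap x a := `|\sum_(t in cell x) (W (tnth a t) (val x.1) (tnth y t) -
  at_mixed W (empirical (cell x) a) (val x.1) (tnth y t))|.
(* The assumption bounds the average gap in a cell of [n] rounds by [K / sqrt n]; multiplying by [n]
   gives [K * sqrt n]. *)
have gapP x : E (gap x) <= K * Num.sqrt #|cell x|%:R.
  have [J0|] := posnP #|cell x|.
    rewrite (eq_E_play _ _ _ _ _ (h := fun=> 0)) ?E_play_cst ?mulr_ge0 ?sqrtr_ge0// => a.
    by rewrite /gap (cards0_eq J0) big_set0 normr0.
  have cellE : [set t : 'I_T | (tnth (play_policies psi pi) t,
      tnth (play_recs tb psi pi) t) == (val x.1, x.2)]%SET = cell x.
    by apply/setP => t; rewrite !inE !tnth_mktuple.
  move=> J0; have := @nsi (val x.1) x.2; rewrite cellE => /(_ J0).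
  move=> H; have {H} : #|cell x|%:R^-1 * E (gap x) <= K / Num.sqrt #|cell x|%:R.
    by case: H => HU HV; case: WUV => WE; rewrite /gap WE.
  have n0 : 0 < #|cell x|%:R :> R by rewrite ltr0n.
  rewrite mulrC ler_pdivrMr// => /le_trans; apply.
  rewrite -mulrA ler_wpM2l// -{2}(sqr_sqrtr (ltW n0)) expr2 mulKf//.
  by rewrite gt_eqF// sqrtr_gt0.
have sums a : `|\sum_t W (tnth a t) (psi (tnth pi t)) (tnth y t) -
   \sum_t mixed_prior W (play_mix a t) (psi (tnth pi t)) (tnth pi t)| <=
   \sum_x (gap x a + T%:R * bias (cell_event x) pi y).
  rewrite -sumrB sum_cells; apply: le_trans (ler_norm_sum _ _ _) _.
  apply: ler_sum => x _.
  have [J0|J0] := posnP #|cell x|.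
    rewrite (cards0_eq J0) big_set0 normr0; apply: addr_ge0; first exact: normr_ge0.
    by apply: mulr_ge0; [exact: ler0n|exact: bias_ge0].
  set m := empirical (cell x) a.
  have m01 z : 0 <= at_mixed W m (val x.1) z <= 1.
    by apply: at_mixed01 => //; [exact: empirical_ge0|exact: empirical_sum].
  (* The mix [m] depends on the realized actions; this is harmless, as [bias_gap] is uniform over
     functions with values in [[0, 1]]. *)
  have := @bias_gap R T pi y (cell_event x) _ T_gt0 m01 => h.
  rewrite [X in `|X| <= _](_ : _ =
    \sum_(t in cell x) (W (tnth a t) (val x.1) (tnth y t) - at_mixed W m (val x.1) (tnth y t)) -
    \sum_(t < T | cell_event x (tnth pi t)) (\sum_z tnth pi t z * at_mixed W m (val x.1) z
       - at_mixed W m (val x.1) (tnth y t))).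
    by apply: le_trans (ler_normD _ _) _; apply: lerD; [exact: lexx|rewrite normrN].
  rewrite [X in _ - X](eq_bigl (mem (cell x))); last by move=> t; rewrite /= inE.
  rewrite -sumrB; apply: eq_bigr => t; rewrite in_cell => /eqP xt.
  rewrite mixed_priorE /play_mix xt -/m -[psi (tnth pi t)]/(val (cell_of t).1) xt.
  by rewrite opprB addrA subrK.
rewrite -E_playB; apply: le_trans (E_play_norm _ _ _ _ _ _) _.
apply: le_trans (E_play_le _ _ _ _ _ sums) _.
rewrite E_play_sum.
under eq_bigr do rewrite E_playD E_play_cst.
rewrite big_split/= -mulr_sumr lerD2r -cell_card_sum.
apply: le_trans (_ : \sum_x K * Num.sqrt #|cell x|%:R <= _); first exact: ler_sum.
by rewrite -mulr_sumr ler_wpM2l// sum_sqrt_le.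
Qed.

End Play.

Section Transfer.
Variables (R : realType) (I : persuasion R) (tb : tie_breaking I) (L : learner I).
Variables (psi : belief R -> policy I) (T : nat).
Variables (pi : T.-tuple (belief R)) (y : T.-tuple bool).
Variables (O : {fset policy I}) (K es : R).
Hypotheses (T_gt0 : (0 < T)%N) (psiO : forall m, psi m \in O) (K0 : 0 <= K).
Hypothesis nsi : no_secret_info_play tb L psi pi y K.
Hypothesis swap : swap_regret_le tb L psi pi y es.

Notation E := (E_play tb L psi pi y).
Notation pol t := (psi (tnth pi t)).
Notation rec t := (astar tb (psi (tnth pi t)) (tnth pi t)).
Notation mix a t := (play_mix tb pi psiO a t).
Notation total_bias := (\sum_(x : O * action I) bias (cell_event tb psi x) pi y).
Notation error := (estimate_error tb psi pi y O K).

Lemma play_mix_ge0 a t b : 0 <= mix a t b.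
Proof. exact: empirical_ge0. Qed.

Lemma play_mix_sum a t : \sum_b mix a t b = 1.
Proof.
apply: empirical_sum; rewrite card_gt0; apply/set0Pn; exists t.
by rewrite (in_cell tb pi psiO).
Qed.

(** The map sending [(p, r, a)] to [r] is one of the competitors in the contextual swap regret. *)
Lemma obedience_swap :
  \sum_t U (rec t) (pol t) (tnth y t)
    - E (fun a => \sum_t U (tnth a t) (pol t) (tnth y t)) <= T%:R * es.
Proof.
have Tr : 0 < T%:R :> R by rewrite ltr0n.
rewrite -ler_pdivrMl// -(E_play_cst tb L psi pi y (\sum_t _)) -E_playB -E_playZ.
apply: le_trans swap; apply: E_play_le => a.
rewrite -sumrB.
have -> : T%:R^-1 * \sum_t (U (rec t) (pol t) (tnth y t) - U (tnth a t) (pol t) (tnth y t))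
  = T%:R^-1 * \sum_(t < T)
      (U ((fun x : policy I * action I * action I => x.1.2) (tnth (play_policies psi pi) t,
          tnth (play_recs tb psi pi) t, tnth a t)) (tnth (play_policies psi pi) t) (tnth y t)
         - U (tnth a t) (tnth (play_policies psi pi) t) (tnth y t)).
  by congr (_ * _); apply: eq_bigr => t _; rewrite !tnth_mktuple.
(* A supremum dominates its members only when the set is bounded; here average utility differences
   are at most 1. *)
apply: ub_le_sup; last by exists (fun x => x.1.2).
exists 1 => _ [h _ <-]; rewrite ler_pdivrMl// mulr1.
apply: le_trans (_ : \sum_(t < T) 1 <= _); last by rewrite sumr_const card_ord.
apply: ler_sum => t _; set u := U _ _ _; set u' := U _ _ _.
have : 0 <= u <= 1 by exact: U01.
have : 0 <= u' <= 1 by exact: U01.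
lra.
Qed.

Lemma recommendation_bias :
  \sum_t at_prior (@U R I) (rec t) (pol t) (tnth pi t)
    - \sum_t U (rec t) (pol t) (tnth y t) <= T%:R * total_bias.
Proof.
rewrite -sumrB (sum_cells tb pi psiO) mulr_sumr; apply: ler_sum => x _.
apply: le_trans (ler_norm _) _.
apply: le_trans (bias_gap _ _ _ T_gt0 (fun z => U01 x.2 (val x.1) z)).
rewrite [X in `|X| <= _](_ : _ =  \sum_(t < T | cell_event tb psi x (tnth pi t))
  (\sum_z tnth pi t z * U x.2 (\val x.1) z - U x.2 (\val x.1) (tnth y t)))//.
rewrite [RHS](eq_bigl (mem (cell tb psi pi x))); last by move=> t; rewrite /= inE.
apply: eq_bigr => t; rewrite (in_cell tb pi psiO) => /eqP <-.
by [].
Qed.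

Lemma play_regret :
  \sum_t at_prior (@U R I) (rec t) (pol t) (tnth pi t)
    - E (fun a => \sum_t mixed_prior (@U R I) (mix a t) (pol t) (tnth pi t))
  <= T%:R * es + error + T%:R * total_bias.
Proof.
have := obedience_swap; have := recommendation_bias.
have := play_estimate T_gt0 psiO K0 nsi (or_introl erefl).
by rewrite ler_norml => /andP[_]; lra.
Qed.

(* The hypothesis is affine in b, hence survives averaging over the empirical
   mix of the actions played in a cell. *)
Lemma value_transfer (e k : R) (v : 'I_T -> R) : `|e| <= 1 -> 0 <= k ->
  (forall t b, e * (at_prior (@V R I) b (pol t) (tnth pi t) - v t) <=
    k * (at_prior (@U R I) (rec t) (pol t) (tnth pi t)
      - at_prior (@U R I) b (pol t) (tnth pi t))) ->
  e * (E (fun a => \sum_t V (tnth a t) (pol t) (tnth y t)) - \sum_t v t) <=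
    k * (T%:R * es + error + T%:R * total_bias) + error.
Proof.
move=> e1 k0 H.
have h1 := play_estimate T_gt0 psiO K0 nsi (or_intror erefl).
have h2 : k * (\sum_t at_prior (@U R I) (rec t) (pol t) (tnth pi t)
    - E (fun a => \sum_t mixed_prior (@U R I) (mix a t) (pol t) (tnth pi t))) <=
    k * (T%:R * es + error + T%:R * total_bias).
  by rewrite ler_wpM2l// play_regret.
have h3 : e * (E (fun a => \sum_t mixed_prior (@V R I) (mix a t) (pol t) (tnth pi t))
    - \sum_t v t) <=
  k * (\sum_t at_prior (@U R I) (rec t) (pol t) (tnth pi t)
    - E (fun a => \sum_t mixed_prior (@U R I) (mix a t) (pol t) (tnth pi t))).
  rewrite -(E_play_cst tb L psi pi y (\sum_t v t)) -E_playB -E_playZ.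
  rewrite -(E_play_cst tb L psi pi y (\sum_t at_prior _ _ _ _)) -E_playB -E_playZ.
  apply: E_play_le => a; rewrite -!sumrB !mulr_sumr; apply: ler_sum => t _.
  rewrite /mixed_prior -[v t]mul1r -(play_mix_sum a t) mulr_suml -sumrB mulr_sumr.
  rewrite -[at_prior _ (rec t) _ _]mul1r -(play_mix_sum a t) mulr_suml -sumrB mulr_sumr.
  apply: ler_sum => b _; rewrite -!mulrBr mulrCA [leRHS]mulrCA.
  by rewrite ler_wpM2l ?play_mix_ge0.
set X := E _ in h1 h2 h3 *; set Y := E (fun a => \sum_t mixed_prior (@V R I) _ _ _) in h1 h3.
have h4 : e * (X - Y) <= error.
  apply: le_trans (ler_norm _) _; rewrite normrM; apply: le_trans h1.
  by rewrite ler_piMl.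
lra.
Qed.

End Transfer.

Lemma no_secret_info_play_le (R : realType) (I : persuasion R)
    (tb : tie_breaking I) (L : learner I) psi (T : nat) (pi : T.-tuple (belief R))
    (y : T.-tuple bool) (K K' : R) : K <= K' ->
  no_secret_info_play tb L psi pi y K -> no_secret_info_play tb L psi pi y K'.
Proof.
move=> KK nsi p r J gap J0; have [hU hV] := @nsi p r J0.
have s0 : 0 <= (Num.sqrt #|J|%:R : R)^-1 by rewrite invr_ge0 sqrtr_ge0.
by split; [apply: le_trans hU _|apply: le_trans hV _]; rewrite ler_wpM2r.
Qed.

Section Regret.
Variables (R : realType) (I : persuasion R) (tb : tie_breaking I) (L : learner I).
Variables (P0 : {fset policy I}) (psi : belief R -> policy I) (T : nat).
Variables (pi : T.-tuple (belief R)) (y : T.-tuple bool).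
Variables (O : {fset policy I}) (K es c eps b gam : R).
Hypotheses (T_gt0 : (0 < T)%N) (psiO : forall m, psi m \in O) (K0 : 0 <= K).
Hypotheses (eps0 : 0 < eps) (b0 : 0 < b) (gam0 : 0 <= gam).
Hypothesis nsi : no_secret_information tb P0 L psi pi y K.
Hypothesis swap : no_contextual_swap_regret tb P0 L psi pi y es.
Hypothesis oracle : optimal_stable_oracle tb P0 c eps b gam psi.

Notation rec t := (astar tb (psi (tnth pi t)) (tnth pi t)).

Definition oracle_bias : R :=
  \sum_(x : O * action I) bias (cell_event tb psi x) pi y.

Definition benchmark_bias : R :=
  \sum_(x : P0 * action I) bias (fun m => astar tb (val x.1) m == x.2) pi y.

(** The loss per round for [N] cells and total bias [B]. The first bracket is the utility regret at
    the forecasts, where the bias enters twice, for the mix and for the recommendations; the second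
    is the error in estimating the value. *)
Definition transfer_loss (k : R) (N : nat) (B : R) : R :=
  k * (es + K * Num.sqrt (N%:R / T%:R) + 2 * B) + (K * Num.sqrt (N%:R / T%:R) + B).

Lemma transfer_lossE k N B :
  k * (T%:R * es + (K * Num.sqrt (N%:R * T%:R) + T%:R * B) + T%:R * B) +
    (K * Num.sqrt (N%:R * T%:R) + T%:R * B) = T%:R * transfer_loss k N B.
Proof.
have T0 : 0 < T%:R :> R by rewrite ltr0n.
have -> : Num.sqrt (N%:R * T%:R) = T%:R * Num.sqrt (N%:R / T%:R) :> R.
  rewrite -[X in _ = X * _](ger0_norm (ltW T0)) -sqrtr_sqr -sqrtrM ?sqr_ge0//.
  by congr Num.sqrt; field; rewrite gt_eqF.
by rewrite /transfer_loss; ring.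
Qed.

Lemma at_prior01 (W : action I -> policy I -> bool -> R) a p m :
  (forall a p z, 0 <= W a p z <= 1) -> 0 <= at_prior W a p m <= 1.
Proof.
move=> W01; rewrite sumr_ge0/= => [|z _]; last first.
  by rewrite mulr_ge0 ?dist_ge0//; case/andP: (W01 a p z).
rewrite -(dist_sum m); apply: ler_sum => z _.
by rewrite ler_piMr ?dist_ge0//; case/andP: (W01 a p z).
Qed.

(** By stability, an action worse than the recommendation by more than [gam] in value loses at least
    [b] in utility; its value loss is at most 1, hence at most [b^-1] times the utility loss.
    [value_transfer] is used with [e = -1]. *)
Lemma principal_value_ge :
  \sum_t (at_prior (@V R I) (rec t) (psi (tnth pi t)) (tnth pi t) - gam)
    - E_play tb L psi pi y (fun a => \sum_t V (tnth a t) (psi (tnth pi t)) (tnth y t))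
  <= T%:R * transfer_loss b^-1 #|{: O * action I}| oracle_bias.
Proof.
rewrite -transfer_lossE.
have [n1 _] := nsi; have [s1 _] := swap.
have := value_transfer T_gt0 psiO K0 n1 s1 (e := -1) (k := b^-1)
  (v := fun t => at_prior (@V R I) (rec t) (psi (tnth pi t)) (tnth pi t) - gam).
rewrite mulN1r opprB; apply.
- by rewrite normrN normr1.
- by rewrite invr_ge0 ltW.
move=> t a; rewrite mulN1r opprB; have gam_ge0 := gam0.
have [/(_ a) best _] := astarP tb (psi (tnth pi t)) (tnth pi t).
set u := at_prior _ (rec t) _ _ in best *; set v := at_prior _ (rec t) _ _.
have v01 : 0 <= v <= 1 by exact: (at_prior01 _ _ _ (@V01 R I)).
have w01 := at_prior01 a (psi (tnth pi t)) (tnth pi t) (@V01 R I).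
have k0 : 0 <= b^-1 * (u - at_prior (@U R I) a (psi (tnth pi t)) (tnth pi t)).
  by rewrite mulr_ge0 ?subr_ge0// invr_ge0 ltW.
have [->|ar] := eqVneq a (rec t); first by rewrite /u subrr mulr0 /v; lra.
have [st _] := oracle (tnth pi t).
case: (st a); first exact/eqP.
  rewrite -/u => ub; apply: le_trans (_ : 1 <= _); first by lra.
  by rewrite mulrC ler_pdivlMr// mul1r; lra.
by rewrite -/v => h; apply: le_trans k0; lra.
Qed.

(** An action within [eps] of the best response is no better than [astar_eps] for the Principal; any
    other loses more than [eps] in utility, so [eps^-1] times its loss exceeds every difference of
    values. [value_transfer] is used with [e = 1]. *)
Lemma benchmark_value_le (p0 : policy I) : p0 \in P0 ->
  E_play tb L (fun=> p0) pi y (fun a => \sum_t V (tnth a t) p0 (tnth y t))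
   - \sum_t at_prior (@V R I) (astar_eps tb p0 (tnth pi t) eps) p0 (tnth pi t)
  <= T%:R * transfer_loss eps^-1 #|action I| benchmark_bias.
Proof.
move=> p0P; have [_ /(_ _ p0P) n1] := nsi; have [_ /(_ _ p0P) s1] := swap.
have pO : forall m : belief R, (fun=> p0) m \in [fset p0]%fset.
  by move=> m; rewrite inE.
have := value_transfer T_gt0 pO K0 n1 s1 (e := 1) (k := eps^-1)
  (v := fun t => at_prior (@V R I) (astar_eps tb p0 (tnth pi t) eps) p0 (tnth pi t)).
rewrite mul1r /estimate_error transfer_lossE card_prod -cardfE cardfs1 mul1n.
set B := \sum_(x : [fset p0]%fset * action I) bias (cell_event tb (fun=> p0) x) pi y.
(* The cells of the constant mechanism are the terms of [p0] in the sum over [P0]. *)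
have BB : B <= benchmark_bias.
  have -> : B = \sum_(x1 : [fset p0]%fset) \sum_(x2 : action I)
      bias (cell_event tb (fun=> p0) (x1, x2)) pi y.
    by rewrite pair_bigA; apply: eq_bigr => -[].
  rewrite (eq_bigr (fun=> \sum_a bias (fun m => astar tb p0 m == a) pi y)); last first.
    move=> [x xp] _; apply: eq_bigr => a _; congr bias; apply/funext => m.
    rewrite /cell_event/= xpair_eqE (_ : p0 == x)//.
    by rewrite eq_sym; apply/eqP/fset1P.
  rewrite sumr_const -cardfE cardfs1 mulr1n /benchmark_bias.
  rewrite -(pair_bigA _ (fun (x1 : P0) (x2 : action I) =>
    bias (fun m => astar tb (val x1) m == x2) pi y))/=.
  rewrite (bigD1 [` p0P]%fset)//= lerDl sumr_ge0// => x _.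
  by rewrite sumr_ge0// => a _; exact: bias_ge0.
have mono : transfer_loss eps^-1 #|action I| B <=
    transfer_loss eps^-1 #|action I| benchmark_bias.
  rewrite /transfer_loss lerD ?lerD2l// ler_wpM2l ?invr_ge0 ?(ltW eps0)//.
  by rewrite lerD2l ler_wpM2l.
move=> H; apply: le_trans (_ : T%:R * transfer_loss eps^-1 #|action I| B <= _); last first.
  by rewrite ler_wpM2l.
apply: H; first by rewrite normr1.
  by rewrite invr_ge0 ltW.
move=> t a; rewrite mul1r.
have [best _] := astarP tb p0 (tnth pi t).
set u := at_prior _ (astar _ _ _) _ _ in best *; set v := at_prior _ (astar_eps _ _ _ _) _ _.
have v01 : 0 <= v <= 1 by exact: (at_prior01 _ _ _ (@V01 R I)).
have w01 := at_prior01 a p0 (tnth pi t) (@V01 R I).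
have k0 : 0 <= eps^-1 * (u - at_prior (@U R I) a p0 (tnth pi t)).
  by rewrite mulr_ge0 ?subr_ge0 ?best// invr_ge0 ltW.
have [le_a|lt_a] := leP (u - eps) (at_prior (@U R I) a p0 (tnth pi t)).
  have [_ /= /(_ a) opt] := astar_epsP tb p0 (tnth pi t) (ltW eps0).
  by apply: le_trans k0; rewrite subr_le0; exact: opt le_a.
apply: le_trans (_ : 1 <= _).
  case/andP: v01 => v0 _; case/andP: w01 => _ w1.
  by rewrite (le_trans (lerB w1 v0))// subr0.
by rewrite mulrC ler_pdivlMr// mul1r lerBrDr addrC -lerBrDr ltW.
Qed.

(** The realized benchmark value is compared with that of [astar_eps] at the forecasts, this with
    the value of the oracle up to [c], and the latter with the realized value up to [gam]. *)
Lemma PR_forecasts_le : P0 != fset0 ->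
  PR_forecasts tb P0 L psi pi y <= c + gam
    + transfer_loss b^-1 #|{: O * action I}| oracle_bias
    + transfer_loss eps^-1 #|action I| benchmark_bias.
Proof.
move=> /fset0Pn[q qP]; apply: ge_sup.
  by exists (E_play tb L psi pi y (fun a => E_play tb L (fun=> q) pi y (fun a0 =>
    T%:R^-1 * \sum_(t < T) (V (tnth a0 t) q (tnth y t)
                - V (tnth a t) (psi (tnth pi t)) (tnth y t))))); exists q.
move=> _ [p0 p0P <-]; have Tr : 0 < T%:R :> R by rewrite ltr0n.
rewrite (eq_E_play tb L psi pi y (h := fun a => T%:R^-1 *
  (E_play tb L (fun=> p0) pi y (fun a0 => \sum_t V (tnth a0 t) p0 (tnth y t)) -
   \sum_t V (tnth a t) (psi (tnth pi t)) (tnth y t)))); last first.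
  move=> a; rewrite E_playZ; congr (_ * _).
  rewrite -[X in _ - X](E_play_cst tb L (fun=> p0) pi y) -E_playB.
  by apply: eq_E_play => a0; rewrite -sumrB.
rewrite E_playZ E_playB E_play_cst ler_pdivrMl//.
have h1 := principal_value_ge; have h2 := benchmark_value_le p0P.
have h3 : \sum_t at_prior (@V R I) (astar_eps tb p0 (tnth pi t) eps) p0 (tnth pi t)
    <= \sum_t (at_prior (@V R I) (rec t) (psi (tnth pi t)) (tnth pi t) - gam)
      + T%:R * (c + gam).
  rewrite -[T in T%:R * _]card_ord mulr_natl -sumr_const -big_split/=.
  by apply: ler_sum => t _; have [_ /(_ _ p0P)] := oracle (tnth pi t); lra.
rewrite 2!mulrDr; lra.
Qed.

End Regret.

(** * Expected regret *)

Section SeedExpectation.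
Context (R : realType) (d : measure_display) (S : measurableType d).
Variable P : probability S R.
Implicit Types f h : S -> R.

(* f need not be measurable: the integral of its positive part is a supremum
   over the simple functions below it. *)
Lemma expectation_le_nonneg f h : (forall w, 0 <= h w) ->
  (forall w, f w <= h w) -> ('E_P[f] <= 'E_P[h])%E.
Proof.
move=> h0 fh; rewrite unlock integralE.
apply: le_trans (_ : (\int[P]_w (((fun w => (f w)%:E) ^\+)%E w) <= _)%E).
  by rewrite -[leRHS]sube0; apply: leeB => //; exact: integral_ge0.
rewrite !ge0_integralTE//.
apply: ereal_sup_le => _ [k kf <-]; exists k => // w.
apply: le_trans (kf w) _; rewrite funeposE/=.
by rewrite ge_max !lee_fin fh h0.
Qed.

Lemma expectation_scale (k : R) f : measurable_fun setT f -> (forall w, 0 <= f w) ->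
  0 <= k -> ('E_P[fun w => (k * f w)%R] = k%:E * 'E_P[f])%E.
Proof.
move=> mf f0 k0; rewrite unlock -ge0_integralZl_EFin//.
  by move=> w _; rewrite lee_fin.
exact/measurable_EFinP.
Qed.

Lemma expectation_add f h :
  measurable_fun setT f -> (forall w, 0 <= f w) ->
  measurable_fun setT h -> (forall w, 0 <= h w) ->
  ('E_P[fun w => (f w + h w)%R] = 'E_P[f] + 'E_P[h])%E.
Proof.
move=> mf f0 mh h0; rewrite unlock -ge0_integralD//.
- by move=> w _; rewrite lee_fin.
- exact/measurable_EFinP.
- by move=> w _; rewrite lee_fin.
- exact/measurable_EFinP.
Qed.

Lemma expectation_big (X : finType) (f : X -> S -> R) :
  (forall x, measurable_fun setT (f x)) -> (forall x w, 0 <= f x w) ->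
  ('E_P[fun w => (\sum_x f x w)%R] = \sum_x 'E_P[f x])%E.
Proof.
move=> mf f0; rewrite unlock -ge0_integral_sum//.
- by apply: eq_integral => w _; rewrite sumEFin.
- by move=> x; exact/measurable_EFinP.
- by move=> x w _; rewrite lee_fin.
Qed.

End SeedExpectation.

Section Forecasts.
Variables (R : realType) (F : forecaster R) (T : nat) (y : T.-tuple bool).
Variable D : belief R -> bool.
Hypothesis mD : forall h : seq bool, measurable [set w : seed F | D (forecast w h)].

Lemma event_measurable (h : seq bool) :
  measurable_fun setT (fun w : seed F => (D (forecast w h))%:R : R).
Proof.
rewrite (_ : (fun w => _) = \1_[set w : seed F | D (forecast w h)]).
  exact: measurable_indic.
apply/funext => w; rewrite indicE; congr ((nat_of_bool _)%:R).
by apply/idP/idP; rewrite inE.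
Qed.

Lemma bias_measurable :
  measurable_fun setT (fun w : seed F => bias D (forecasts w y) y).
Proof.
rewrite /bias; apply: measurable_funM; first exact: measurable_cst.
apply: measurable_sum => z.
apply: (measurableT_comp (f := fun r : R => `|r|)).
  by apply: continuous_measurable_fun; exact: norm_continuous.
apply: measurable_sum => t; under eq_fun do rewrite tnth_mktuple.
apply: measurable_funM; first exact: event_measurable.
by apply: measurable_funB; [exact: forecast_measurable|exact: measurable_cst].
Qed.

Lemma n_roundsE (pi : T.-tuple (belief R)) :
  (n_rounds D pi)%:R = \sum_t (D (tnth pi t))%:R :> R.
Proof.
rewrite /n_rounds -sum1_card natr_sum big_mkcond/=.
by apply: eq_bigr => t _; rewrite inE; case: (D _).
Qed.

Lemma n_rounds_le (pi : T.-tuple (belief R)) : (n_rounds D pi <= T)%N.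
Proof. by rewrite -{2}[T]card_ord max_card. Qed.

Lemma bias_rate_measurable (EE : set (belief R -> bool)) :
  measurable_fun setT (fun w : seed F => bias_rate EE D (forecasts w y)).
Proof.
rewrite /bias_rate; apply: measurable_funD; first exact: measurable_cst.
apply: measurable_funM; last exact: measurable_cst.
apply: measurable_funM; first exact: measurable_cst.
apply: (measurableT_comp (f := fun r : R => Num.sqrt r)).
  by apply: continuous_measurable_fun; exact: sqrt_continuous.
apply: measurable_funM; first exact: measurable_cst.
under eq_fun do rewrite n_roundsE.
apply: measurable_sum => t; under eq_fun do rewrite tnth_mktuple.
exact: event_measurable.
Qed.

End Forecasts.

Lemma ln_nat_ge0 (R : realType) (n : nat) : 0 <= ln (n%:R : R).
Proof.
case: n => [|n]; first by rewrite ln0.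
by rewrite ln_ge0// ler1n.
Qed.

Lemma bias_rate_ge0 (R : realType) (T : nat) (EE : set (belief R -> bool)) D
  (pi : T.-tuple (belief R)) : 0 <= bias_rate EE D pi.
Proof.
by rewrite addr_ge0// ?mulr_ge0// ?invr_ge0// ?ln_nat_ge0// sqrtr_ge0.
Qed.

Section TotalBias.
Variables (R : realType) (F : forecaster R) (T : nat) (y : T.-tuple bool).
Variables (X : finType) (D : X -> belief R -> bool) (EE : set (belief R -> bool)).
Variables (K M l : R).
Hypothesis T_gt0 : (0 < T)%N.
Hypothesis unb : unbiased_forecaster K T EE F.
Hypothesis DE : forall x, EE (D x).
Hypothesis DM : forall w : seed F,
  \sum_x (n_rounds (D x) (forecasts w y))%:R <= M * T%:R.
Hypothesis lE : ln ((2 * #|` fset_set EE | * T)%N%:R) <= l.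

(** The rates are summed before the expectation is taken: for each seed the events occur at most
    [M * T] times in all, and Cauchy-Schwarz bounds the sum of the square roots. *)
Lemma total_bias_expectation :
  (\sum_x 'E_(seed_law F)[fun w => bias (D x) (forecasts w y) y] <=
    (`|K| * (2 * l * #|X|%:R / T%:R
      + 2 * Num.sqrt (l * #|X|%:R * M / T%:R)))%:E)%E.
Proof.
have T0 : 0 < T%:R :> R by rewrite ltr0n.
have mD x := proj1 (unb (DE x)).
have l0 : 0 <= l by apply: le_trans lE; exact: ln_nat_ge0.
have mrate x := bias_rate_measurable y (mD x) EE.
apply: le_trans (_ : \sum_x `|K|%:E *
    'E_(seed_law F)[fun w => bias_rate EE (D x) (forecasts w y)] <= _)%E.
  apply: lee_sum => x _; apply: le_trans (proj2 (unb (DE x)) y) _.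
  apply: lee_wpmul2r; last by rewrite lee_fin ler_norm.
  by apply: expectation_ge0 => w; exact: bias_rate_ge0.
rewrite -ge0_sume_distrr; last first.
  by move=> x _; apply: expectation_ge0 => w; exact: bias_rate_ge0.
rewrite -expectation_big//; last by move=> x w; exact: bias_rate_ge0.
rewrite EFinM; apply: lee_wpmul2l; first by rewrite lee_fin.
set B := (X in (_ <= X%:E)%E).
apply: le_trans (_ : ('E_(seed_law F)[cst B] <= _)%E); last by rewrite expectation_cst.
have M0 : 0 <= M.
  rewrite -(pmulr_lge0 _ T0); apply: le_trans (DM point).
  by rewrite sumr_ge0.
apply: expectation_le_nonneg => w.
  by rewrite addr_ge0 ?mulr_ge0 ?invr_ge0 ?sqrtr_ge0.
rewrite /bias_rate card_bool big_split/= sumr_const; apply: lerD.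
  rewrite -[leLHS]mulr_natr mulrAC ler_wpM2r ?invr_ge0// -!mulrA ler_wpM2l//.
  by rewrite ler_wpM2r.
rewrite -mulr_suml -mulr_sumr ler_pdivrMr//.
set n := fun x => (n_rounds (D x) (forecasts w y))%:R : R.
have le_sum : \sum_x Num.sqrt (l * n x) <= Num.sqrt (l * #|X|%:R * M / T%:R) * T%:R.
  apply: le_trans (sum_sqrt_le _) _; first by move=> x; rewrite mulr_ge0 ?ler0n.
  rewrite -[X in _ <= _ * X](ger0_norm (ltW T0)) -sqrtr_sqr -sqrtrM.
    apply: ler_wsqrtr; rewrite -mulr_sumr.
    have -> : l * #|X|%:R * M / T%:R * T%:R ^+ 2 = #|X|%:R * (l * (M * T%:R)).
      by field; rewrite gt_eqF.
    by rewrite ler_wpM2l// ler_wpM2l//; exact: DM.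
  by rewrite mulr_ge0 ?invr_ge0// mulr_ge0// mulr_ge0.
rewrite -[leRHS]mulrA ler_wpM2l//; apply: le_trans le_sum.
by apply: ler_sum => x _; rewrite ler_wsqrtr// ler_wpM2r// ler0n.
Qed.

End TotalBias.

Section PrincipalRegret.
Variables (R : realType) (I : persuasion R) (tb : tie_breaking I) (L : learner I).
Variables (P0 : {fset policy I}) (psi popt : belief R -> policy I) (T : nat).
Variables (F : forecaster R) (y : T.-tuple bool).
Variables (Kfc K es c eps b gam l : R).
Hypotheses (T_gt0 : (0 < T)%N) (P0n0 : P0 != fset0) (K0 : 0 <= K).
Hypotheses (eps0 : 0 < eps) (b0 : 0 < b) (gam0 : 0 <= gam) (c0 : 0 <= c)
  (es0 : 0 <= es).
Hypothesis fin : finite_set (outputs psi).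

Let O := fset_set (outputs psi).
Let EE := events1 tb psi `|` events2 tb P0 eps popt `|` events3 tb P0.

Hypothesis unb : unbiased_forecaster Kfc T EE F.
Hypothesis lE : ln ((2 * #|` fset_set EE | * T)%N%:R) <= l.
Hypothesis nsi : forall w : seed F,
  no_secret_information tb P0 L psi (forecasts w y) y K.
Hypothesis swap : forall w : seed F,
  no_contextual_swap_regret tb P0 L psi (forecasts w y) y es.
Hypothesis oracle : optimal_stable_oracle tb P0 c eps b gam psi.

Definition bias_bound (N : nat) (M : R) : R :=
  `|Kfc| * (2 * l * N%:R / T%:R + 2 * Num.sqrt (l * N%:R * M / T%:R)).

Lemma psi_outputs m : psi m \in O.
Proof. by rewrite in_fset_set//; apply/mem_set; exists m. Qed.

Lemma oracle_event (x : O * action I) : EE (cell_event tb psi x).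
Proof.
left; left; exists (val x.1); last by exists x.2.
by have := valP x.1; rewrite in_fset_set// => /set_mem.
Qed.

Lemma benchmark_event (x : P0 * action I) : EE (fun m => astar tb (val x.1) m == x.2).
Proof. by right; exists (val x.1); [exact: valP|exists x.2]. Qed.

(** The bias is the only random part of the loss and enters affinely, so the expectation passes
    through. *)
Lemma transfer_loss_split k N B :
  transfer_loss T K es k N B = transfer_loss T K es k N 0 + (2 * k + 1) * B.
Proof. by rewrite /transfer_loss; ring. Qed.

Lemma PR_le : (PR tb P0 L (F, psi) y <=
  (c + gam + transfer_loss T K es b^-1 (#|` O| * #|action I|)
       (bias_bound (#|` O| * #|action I|) 1)
     + transfer_loss T K es eps^-1 #|action I|
       (bias_bound (#|` P0| * #|action I|) (#|` P0| * #|action I|)%:R))%:E)%E.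
Proof.
have T0 : 0 < T%:R :> R by rewrite ltr0n.
have bV : 0 <= b^-1 by rewrite invr_ge0 ltW.
have epsV : 0 <= eps^-1 by rewrite invr_ge0 ltW.
have loss0 k N : 0 <= k -> 0 <= transfer_loss T K es k N 0.
  by move=> k0; rewrite /transfer_loss mulr0 !addr0 addr_ge0 ?mulr_ge0 ?addr_ge0
    ?mulr_ge0 ?sqrtr_ge0.
have cO : #|{: O * action I}| = (#|` O| * #|action I|)%N by rewrite card_prod -cardfE.
have cP : #|{: P0 * action I}| = (#|` P0| * #|action I|)%N by rewrite card_prod -cardfE.
set N1 := (#|` O| * #|action I|)%N; set N3 := (#|` P0| * #|action I|)%N.
pose a0 := c + gam + transfer_loss T K es b^-1 N1 0 +
  transfer_loss T K es eps^-1 #|action I| 0.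
have a0_ge0 : 0 <= a0.
  apply: addr_ge0; last exact: loss0.
  by apply: addr_ge0; [exact: addr_ge0|exact: loss0].
pose k1 := 2 * b^-1 + 1; pose k3 := 2 * eps^-1 + 1.
have k1_ge0 : 0 <= k1 by rewrite addr_ge0// mulr_ge0.
have k3_ge0 : 0 <= k3 by rewrite addr_ge0// mulr_ge0.
pose f1 (x : O * action I) (w : seed F) := bias (cell_event tb psi x) (forecasts w y) y.
pose f3 (x : P0 * action I) (w : seed F) :=
  bias (fun m => astar tb (val x.1) m == x.2) (forecasts w y) y.
have f1_ge0 x w : 0 <= f1 x w by exact: bias_ge0.
have f3_ge0 x w : 0 <= f3 x w by exact: bias_ge0.
have mf1 x : measurable_fun setT (f1 x).
  by apply: bias_measurable; exact: (proj1 (unb (oracle_event x))).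
have mf3 x : measurable_fun setT (f3 x).
  by apply: bias_measurable; exact: (proj1 (unb (benchmark_event x))).
pose s1 w := \sum_x f1 x w; pose s3 w := \sum_x f3 x w.
have s1_ge0 w : 0 <= s1 w by rewrite sumr_ge0.
have s3_ge0 w : 0 <= s3 w by rewrite sumr_ge0.
have ms1 : measurable_fun setT s1 by exact: measurable_sum.
have ms3 : measurable_fun setT s3 by exact: measurable_sum.
apply: le_trans (_ : ('E_(seed_law F)[fun w => (a0 + (k1 * s1 w + k3 * s3 w))%R] <= _)%E).
  apply: expectation_le_nonneg => w; first by rewrite addr_ge0// addr_ge0// mulr_ge0.
  apply: le_trans (PR_forecasts_le T_gt0 psi_outputs K0 eps0 b0 gam0 (nsi w) (swap w)
    oracle P0n0) _.
  rewrite cO (transfer_loss_split _ N1) (transfer_loss_split _ #|action I|).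
  rewrite (_ : oracle_bias _ _ _ _ _ = s1 w)// (_ : benchmark_bias _ _ _ _ = s3 w)//.
  by rewrite /a0 /k1 /k3; lra.
have mk1 : measurable_fun setT (fun w => k1 * s1 w).
  by apply: measurable_funM => //; exact: measurable_cst.
have mk3 : measurable_fun setT (fun w => k3 * s3 w).
  by apply: measurable_funM => //; exact: measurable_cst.
rewrite expectation_add//; last 2 first.
- exact: measurable_funD.
- by move=> w; rewrite addr_ge0// mulr_ge0.
rewrite (_ : (fun=> a0) = cst a0)// expectation_cst.
rewrite expectation_add//; last 2 first.
- by move=> w; rewrite mulr_ge0.
- by move=> w; rewrite mulr_ge0.
rewrite !expectation_scale// /s1 /s3 !expectation_big//.
(* The oracle cells partition the rounds, hence [M = 1]. *)
have h1 : (\sum_x 'E_(seed_law F)[f1 x] <= (bias_bound N1 1)%:E)%E.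
  rewrite /bias_bound /N1 -cO.
  apply: (total_bias_expectation T_gt0 unb oracle_event _ lE) => w.
  rewrite mul1r -(cell_card_sum tb (forecasts w y) psi_outputs).
  by apply: ler_sum => x _.
(* Events of different benchmark policies overlap; each occurs in at most [T] rounds, so [M] is
   taken to be their number. *)
have h3 : (\sum_x 'E_(seed_law F)[f3 x] <= (bias_bound N3 N3%:R)%:E)%E.
  rewrite /bias_bound /N3 -cP.
  apply: (total_bias_expectation T_gt0 unb benchmark_event _ lE) => w.
  apply: le_trans (_ : \sum_(x : P0 * action I) T%:R <= _).
    by apply: ler_sum => x _; rewrite ler_nat n_rounds_le.
  by rewrite sumr_const mulr_natl.
apply: le_trans (_ : (a0%:E + (k1%:E * (bias_bound N1 1)%:E +
    k3%:E * (bias_bound N3 N3%:R)%:E) <= _)%E).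
  by apply: leeD2l; apply: leeD; apply: lee_wpmul2l => //; rewrite lee_fin.
rewrite -!EFinM -!EFinD lee_fin (transfer_loss_split _ N1).
rewrite [X in _ <= _ + X]transfer_loss_split /a0 /k1 /k3; lra.
Qed.

End PrincipalRegret.

(** * Rates in powers of [tau] *)

Section Rates.
Variables (R : realType).
Implicit Types (tau l s k : R).

(** Here [N / T] is at most [(s * tau^3)^2], so both brackets are of order [tau^3]; the factor [k],
    of order [tau^-2], leaves [tau]. *)
Lemma transfer_loss_le (T : nat) (K es Ks tau s k kap B b : R) (N : nat) :
  0 < tau <= 1 -> T%:R^-1 = tau ^+ 10 -> 0 <= K -> 0 <= s -> 0 <= k ->
  N%:R <= s ^+ 2 * tau ^- 4 -> es <= Ks * s * tau ^+ 3 -> B <= b * tau ^+ 3 ->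
  k <= kap * tau ^- 2 -> 0 <= Ks -> 0 <= b ->
  transfer_loss T K es k N B <= (kap * (Ks * s + K * s + 2 * b) + (K * s + b)) * tau.
Proof.
move=> /andP[t0 t1] TE K0 s0 k0 NE esE BE kE Ks0 b0.
have tn n : 0 < tau ^+ n by exact: exprn_gt0.
have r : Num.sqrt (N%:R / T%:R) <= s * tau ^+ 3.
  have st : 0 <= s * tau ^+ 3 by rewrite mulr_ge0// ltW.
  rewrite -[leRHS](ger0_norm st) -sqrtr_sqr ler_wsqrtr// TE.
  rewrite (_ : (s * tau ^+ 3) ^+ 2 = s ^+ 2 * tau ^- 4 * tau ^+ 10).
    by rewrite ler_wpM2r// ltW.
  by field; rewrite gt_eqF.
have t3 : tau ^+ 3 <= tau by rewrite -[leRHS]expr1 ler_wiXn2l// ltW.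
have h1 : k * (es + K * Num.sqrt (N%:R / T%:R) + 2 * B) <=
    kap * (Ks * s + K * s + 2 * b) * tau.
  apply: le_trans (_ : k * ((Ks * s + K * s + 2 * b) * tau ^+ 3) <= _).
    rewrite ler_wpM2l//; have : K * Num.sqrt (N%:R / T%:R) <= K * (s * tau ^+ 3).
      by rewrite ler_wpM2l.
    lra.
  have c0 : 0 <= (Ks * s + K * s + 2 * b) * tau ^+ 3.
    by rewrite mulr_ge0 ?(ltW (tn _))// !addr_ge0 ?mulr_ge0.
  apply: le_trans (ler_wpM2r c0 kE) _; rewrite le_eqVlt; apply/orP; left.
  by apply/eqP; field; rewrite gt_eqF.
have h2 : K * Num.sqrt (N%:R / T%:R) <= K * s * tau.
  by rewrite -mulrA ler_wpM2l//; apply: le_trans r _; rewrite ler_wpM2l.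
have h3 : b * tau ^+ 3 <= b * tau by rewrite ler_wpM2l.
rewrite /transfer_loss; lra.
Qed.

(** The square root is of order [tau^3] and dominates the first term, of order [tau^6]; under the
    root, [l <= (1 + l)^2]. *)
Lemma bias_bound_le (T : nat) (Kfc tau s l M : R) (N : nat) :
  0 < tau <= 1 -> T%:R^-1 = tau ^+ 10 -> 0 <= s -> 0 <= l ->
  N%:R <= s ^+ 2 * tau ^- 4 -> N%:R * M <= s ^+ 2 * tau ^- 4 ->
  bias_bound T Kfc l N M <= `|Kfc| * (2 * s ^+ 2 + 2 * s) * (1 + l) * tau ^+ 3.
Proof.
move=> /andP[t0 t1] TE s0 l0 NE NME.
have tn n : 0 < tau ^+ n by exact: exprn_gt0.
have t4 : s ^+ 2 * tau ^- 4 * tau ^+ 10 = (s * tau ^+ 3) ^+ 2.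
  by field; rewrite gt_eqF.
have h1 : l * N%:R / T%:R <= l * s ^+ 2 * tau ^+ 3.
  rewrite -[leLHS]mulrA -[leRHS]mulrA ler_wpM2l// TE.
  apply: le_trans (_ : s ^+ 2 * tau ^- 4 * tau ^+ 10 <= _).
    by rewrite ler_wpM2r// ltW.
  by rewrite t4 exprMn ler_wpM2l ?sqr_ge0// -exprM ler_wiXn2l// ltW.
have h2 : Num.sqrt (l * N%:R * M / T%:R) <= (1 + l) * (s * tau ^+ 3).
  have st : 0 <= (1 + l) * (s * tau ^+ 3).
    by rewrite mulr_ge0 ?addr_ge0// mulr_ge0// ltW.
  rewrite -[leRHS](ger0_norm st) -sqrtr_sqr ler_wsqrtr// [leRHS]exprMn -t4 TE -(mulrA l) -(mulrA l).
  apply: le_trans (_ : l * (s ^+ 2 * tau ^- 4 * tau ^+ 10) <= _).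
    by rewrite ler_wpM2l// ler_wpM2r// ltW.
  rewrite ler_wpM2r ?t4 ?sqr_ge0//.
  have : 0 <= l * l by rewrite mulr_ge0.
  rewrite expr2; lra.
have h3 : 0 <= s ^+ 2 * tau ^+ 3 by rewrite mulr_ge0 ?sqr_ge0 ?(ltW (tn _)).
rewrite /bias_bound -(mulrA `|Kfc|) -(mulrA `|Kfc|) ler_wpM2l//.
have -> : 2 * l * N%:R / T%:R = 2 * (l * N%:R / T%:R) by rewrite !mulrA.
lra.
Qed.

(* s is a common scale for all cell counts: its square times tau^-4 dominates
   n_O a, a, q a and (q a)^2, where n_O is the number of oracle outputs, a the
   number of actions and q the number of benchmark policies. *)
Lemma count_scale (n a q no tau : R) (s := (32 * n + q) * a) :
  1 <= n -> 1 <= a -> 0 <= q -> 0 < tau <= 1 -> 0 <= no ->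
  no <= 1024 * n ^+ 2 * tau ^- 4 ->
  [/\ 1 <= s, no * a <= s ^+ 2 * tau ^- 4, no <= s ^+ 2 * tau ^- 4,
    a <= s ^+ 2 * tau ^- 4 &
    q * a <= s ^+ 2 * tau ^- 4 /\ q * a * (q * a) <= s ^+ 2 * tau ^- 4].
Proof.
move=> n1 a1 q0 /andP[t0 t1] no0 no_t.
have t4 : 1 <= tau ^- 4 by rewrite invf_ge1 ?exprn_gt0// exprn_ile1// ltW.
have a0 : 0 <= a by exact: le_trans a1.
have s1 : 1 <= s.
  rewrite -[1]mulr1 /s; apply: ler_pM => //; lra.
have s_ge0 : 0 <= s by exact: le_trans s1.
have s_sqr : s <= s ^+ 2 by rewrite expr2 ler_peMr.
have s_t : s ^+ 2 <= s ^+ 2 * tau ^- 4 by rewrite ler_peMr// sqr_ge0.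
have N1 : no * a <= s ^+ 2 * tau ^- 4.
  apply: le_trans (_ : 1024 * n ^+ 2 * tau ^- 4 * a <= _); first by rewrite ler_wpM2r.
  rewrite mulrAC ler_wpM2r ?(le_trans ler01)//.
  (* The 32 in [s] is the square root of 1024. *)
  have : (32 * n) ^+ 2 * a <= (32 * n + q) ^+ 2 * a ^+ 2.
    apply: ler_pM; rewrite ?sqr_ge0//; last by rewrite expr2 ler_peMr.
    by rewrite lerXn2r ?nnegrE//; lra.
  by rewrite /s !exprMn; lra.
have a_s : a <= s by rewrite /s ler_peMl//; lra.
have qa_s : q * a <= s by rewrite /s ler_wpM2r//; lra.
have qa0 : 0 <= q * a by exact: mulr_ge0.
split=> //; first by apply: le_trans N1; rewrite ler_peMr.
  exact: le_trans a_s (le_trans s_sqr s_t).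
split; first exact: le_trans qa_s (le_trans s_sqr s_t).
by apply: le_trans s_t; rewrite expr2; exact: ler_pM.
Qed.

Lemma rate_log_factor (kap A B b l : R) :
  0 <= kap -> 0 <= A -> 0 <= B -> 0 <= l ->
  kap * (A + B + 2 * (b * (1 + l))) + (B + b * (1 + l)) <=
    (kap * (A + B + 2 * b) + (B + b)) * (1 + l).
Proof.
move=> kap0 A0 B0 l0; have : 0 <= l * (kap * (A + B) + B).
  by rewrite mulr_ge0// addr_ge0// mulr_ge0// addr_ge0.
lra.
Qed.

Lemma add_rates (k z1 z2 l tau X1 X2 : R) :
  0 <= k -> 0 <= l -> 0 <= tau ->
  X1 <= z1 * (1 + l) * tau -> X2 <= z2 * (1 + l) * tau ->
  k * tau + X1 + X2 <= (k + z1 + z2) * (1 + l) * tau.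
Proof.
by move=> k0 l0 tau0; have := mulr_ge0 (mulr_ge0 k0 l0) tau0; lra.
Qed.

(** Since [T >= 2], a constant is absorbed into [ln T] at the price of a factor [1 / ln 2]; the case
    [c = 0] relies on [ln 0 = 0]. *)
Lemma ln_count_le (T c : nat) (m : R) : (1 < T)%N -> 1 <= m -> c%:R <= m * T%:R ->
  ln ((2 * c * T)%N%:R : R) <= (ln (2 * m) / ln 2 + 2) * ln T%:R.
Proof.
move=> T1 m1 cm.
have T0 : 0 < T%:R :> R by rewrite ltr0n ltnW.
have ln2 : 0 < ln 2 :> R by rewrite ln_gt0// ltr1n.
have lnT : ln 2 <= ln T%:R :> R by rewrite ler_ln ?posrE// ler_nat.
have m2 : 0 < 2 * m by lra.
have lnm : 0 <= ln (2 * m) by rewrite ln_ge0//; lra.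
apply: le_trans (_ : ln (2 * m * T%:R ^+ 2) <= _).
  have [->|c0] := posnP c.
    rewrite muln0 mul0n ln0// ln_ge0// expr2.
    have : 1 <= T%:R :> R by rewrite ler1n ltnW.
    by move=> T1'; rewrite !mulr_ege1//; lra.
  rewrite ler_ln ?posrE ?ltr0n ?muln_gt0 ?c0 ?(ltnW T1)//.
    by rewrite !natrM expr2 !mulrA ler_wpM2r ?(ltW T0)// -!mulrA ler_wpM2l.
  by rewrite mulr_gt0// exprn_gt0.
rewrite lnM ?posrE ?exprn_gt0// lnXn// [ln T%:R *+ 2]mulr2n.
have : ln (2 * m) <= ln (2 * m) / ln 2 * ln T%:R.
  by rewrite -mulrA ler_peMr// ler_pdivlMl// mulr1.
lra.
Qed.

End Rates.

Lemma events_card (R : realType) (I : persuasion R) (tb : tie_breaking I)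
    (P0 : {fset policy I}) (eps : R) (psi popt : belief R -> policy I) :
  finite_set (outputs psi) -> (forall m, popt m \in P0) ->
  (#|` fset_set (events1 tb psi `|` events2 tb P0 eps popt `|` events3 tb P0)|
    <= (n_outputs psi + 2 * #|` P0|) * #|action I|)%N.
Proof.
move=> fin poptP; set O := fset_set (outputs psi).
pose s1 := [seq cell_event tb psi x | x : O * action I].
pose s2 := [seq (fun m => (popt m, astar_eps tb (popt m) m eps) == (val x.1, x.2))
  | x : P0 * action I].
pose s3 := [seq (fun m => astar tb (val x.1) m == x.2) | x : P0 * action I].
have -> : ((n_outputs psi + 2 * #|` P0|) * #|action I|)%N = size (s1 ++ s2 ++ s3).
  rewrite !size_cat !size_image !card_prod -!cardfE /n_outputs.
  by rewrite mulnDl !addnA mul2n -addnn mulnDl addnA.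
apply: (proj2 (card_fset_set_le _)) => D /=.
rewrite !mem_cat; case=> [[[p pO [a _ <-]]|[p pP [a _ <-]]]|[p pP [a _ <-]]].
- have pO' : p \in O by rewrite in_fset_set//; exact: mem_set.
  by apply/orP; left; apply/mapP; exists ([` pO']%fset, a); rewrite ?mem_enum.
- apply/orP; right; apply/orP; left.
  by apply/mapP; exists ([` pP]%fset, a); rewrite ?mem_enum.
- apply/orP; right; apply/orP; right.
  by apply/mapP; exists ([` pP]%fset, a); rewrite ?mem_enum.
Qed.

(** All fractional powers of [T] become natural powers of [tau], which [field] can handle. *)
Lemma horizon_powers (R : realType) (T : nat) : (1 < T)%N ->
  let tau : R := T%:R `^ (- (1 / 10)) in
  [/\ 0 < tau <= 1, T%:R^-1 = tau ^+ 10,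
    T%:R `^ (- (1 / 5)) = tau ^+ 2 &
    Num.sqrt (T%:R `^ (- (1 / 5))) = tau].
Proof.
move=> T1 tau; have T0 : 0 < T%:R :> R by rewrite ltr0n ltnW.
have t0 : 0 < tau by exact: powR_gt0.
have t10 : T%:R^-1 = tau ^+ 10.
  rewrite -powR_mulrn ?(ltW t0)// -powRrM.
  by rewrite (_ : - (1 / 10) * 10%:R = - 1) ?powR_inv1 ?(ltW T0)//; lra.
have t2 : T%:R `^ (- (1 / 5)) = tau ^+ 2.
  by rewrite -powR_mulrn ?(ltW t0)// -powRrM; congr (_ `^ _); lra.
split=> //; last by rewrite t2 sqrtr_sqr ger0_norm// ltW.
rewrite t0 -(@expr_le1 _ 10) ?(ltW t0)// -t10 invf_le1// ler1n.
exact: ltnW.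
Qed.

Theorem theorem4 (R : realType) :
  exists2 Ksize : R, 0 < Ksize &
  forall I : persuasion R,
  exists C c1 c2 : R, [/\ 0 < C, 0 < c1, 0 < c2 &
  forall (P0 : {fset policy I}) (tb : tie_breaking I), P0 != fset0 ->
  (* [pdelta beta eps x delta] is the oracle for these parameters *)
  exists pdelta : R -> R -> R -> R -> belief R -> policy I,
    (forall beta eps x delta : R,
       0 <= beta < C / 4 -> 0 <= eps <= 1 -> 0 <= x <= 1 ->
       0 < delta -> delta <= beta ^+ 2 / 16 ->
       let o := pdelta beta eps x delta in
       [/\ optimal_stable_oracle tb P0
             (3 * beta / C + c2 * Num.sqrt eps + 2 * Num.sqrt delta)
             eps
             (x * c1 * beta / 2)
             (Num.max x (Num.sqrt delta))
             o,
           finite_set (outputs o) &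
           (n_outputs o)%:R
             <= Ksize * (#|` strat I |%:R ^+ 2 / delta ^+ 2)])
    /\
    (* Kfc, Knsi and Kswap are the constants of the O's in the hypotheses *)
    (forall Kfc Knsi Kswap : R, exists (K : R) (k : nat), forall T : nat,
       let eps := T%:R `^ (- (1 / 5)) in
       let x := Num.sqrt eps in
       let beta := Num.sqrt eps in
       let delta := beta ^+ 2 / 16 in
       let psi := pdelta beta eps x delta in
       (1 < T)%N -> beta < C / 4 ->
       forall (popt : belief R -> policy I) (F : forecaster R)
              (L : learner I) (y : T.-tuple bool),
       is_popt tb P0 eps popt ->
       unbiased_forecaster Kfc T
         (events1 tb psi `|` events2 tb P0 eps popt `|` events3 tb P0) F ->
       (forall w : seed F,
          no_secret_information tb P0 L psi (forecasts w y) y Knsi) ->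
       (forall w : seed F,
          no_contextual_swap_regret tb P0 L psi (forecasts w y) y
            (Kswap * Num.sqrt ((n_outputs psi)%:R / T%:R))) ->
       (PR tb P0 L (F, psi) y
          <= (K * ln T%:R ^+ k * T%:R `^ (- (1 / 10)))%:E)%E)].
Proof.
exists 4 => // I; have [g sep] := separation_exists I.
have /andP[g0 g1] := sep01 sep.
have g2 : 0 < g ^+ 2 by exact: exprn_gt0.
exists (g ^+ 2 / 4), (g ^+ 2 / 8), (4 / g ^+ 2); split; try exact: divr_gt0.
move=> P0 tb P0n0; have [pdelta oracleP] := oracle_exists tb sep P0n0.
exists pdelta; split; first exact: oracleP.
move=> Kfc Knsi Kswap.
set n : R := #|` strat I |%:R; set a := #|action I|; set q := #|` P0|.
pose s : R := (32 * n + q%:R) * a%:R.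
pose m : R := (1024 * n ^+ 2 + 2 * q%:R) * a%:R.
pose b := `|Kfc| * (2 * s ^+ 2 + 2 * s).
pose Z kap := kap * (`|Kswap| * s + `|Knsi| * s + 2 * b) + (`|Knsi| * s + b).
have ln2 : 0 < ln 2 :> R by rewrite ln_gt0// ltr1n.
(* The first two terms collect the optimality gap and [gam]. [Z (16 / g^2)] is the loss of the
   mechanism, whose inverse stability parameter is [16 / g^2 * tau^-2], and [Z 1] that of the
   benchmark, where [eps^-1 = tau^-2]. The last factor bounds [1 + l] by a multiple of [ln T]. *)
exists ((16 / g ^+ 2 + 3 / 2 + Z (16 / g ^+ 2) + Z 1)
  * (1 / ln 2 + (ln (2 * m) / ln 2 + 2))), 1%N.
move=> T eps x beta delta psi T1 betaC popt F L y poptP unb nsi swap.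
rewrite expr1.
have [t01 TE epsE tauE] := horizon_powers R T1.
rewrite /= -/eps in epsE tauE; set tau := T%:R `^ (- (1 / 10)) in t01 TE epsE tauE *.
have /andP[t0 t1] := t01.
have betaE : beta = tau by [].
have deltaE : delta = tau ^+ 2 / 16 by rewrite /delta betaE.
have T0 : 0 < T%:R :> R by rewrite ltr0n ltnW.
have eps01 : 0 <= eps <= 1.
  by rewrite epsE exprn_ge0 ?(ltW t0)// exprn_ile1// ltW.
have delta0 : 0 < delta by rewrite deltaE divr_gt0// exprn_gt0.
have [||orc fin no_le] := oracleP beta eps x delta _ eps01 _ delta0 (lexx _).
- by rewrite betaC andbT sqrtr_ge0.
- by rewrite /x tauE ltW.
rewrite -/psi in orc fin no_le.
have n1 : 1 <= n.
  case/fset0Pn: P0n0 => p _; rewrite ler1n cardfs_gt0.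
  by apply/fset0Pn; exists (val (policy_strat p)); exact: valP.
have a1 : 1 <= a%:R :> R by rewrite ler1n; apply/card_gt0P; exists (obey I).
have q0 : 0 <= q%:R :> R by exact: ler0n.
(* Makes the number of events at most linear in [T], so that its logarithm is of order [ln T]. *)
have t4T : tau ^- 4 <= T%:R.
  rewrite -[leRHS]invrK TE lef_pV2 ?posrE ?exprn_gt0//.
  by apply: ler_wiXn2l => //; exact: ltW.
(* [1024 = 4 * 16^2]: the factor 4 of the output bound and [delta = tau^2 / 16]. *)
have no_t : (n_outputs psi)%:R <= 1024 * n ^+ 2 * tau ^- 4.
  apply: le_trans no_le _; rewrite deltaE -/n le_eqVlt; apply/orP; left.
  by apply/eqP; field; rewrite gt_eqF.
have [s_ge1 N1E noE N2E [N3E N33E]] := count_scale n1 a1 q0 t01 (ler0n R _) no_t.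
rewrite -/s -!natrM in s_ge1 N1E noE N2E N3E N33E.
rewrite natrM in N33E.
have s_ge0 : 0 <= s by exact: le_trans s_ge1.
pose l := (ln (2 * m) / ln 2 + 2) * ln T%:R.
have m1 : 1 <= m.
  apply: le_trans a1 _; rewrite /m ler_peMl// -[leLHS]addr0 lerD ?mulr_ge0//.
  apply: mulr_ege1; first by rewrite ler1n.
  by apply: mulr_ege1.
have lE := ln_count_le T1 m1 (_ : #|` fset_set (events1 tb psi
  `|` events2 tb P0 eps popt `|` events3 tb P0)|%:R <= m * T%:R).
have {}lE : ln ((2 * #|` fset_set (events1 tb psi
  `|` events2 tb P0 eps popt `|` events3 tb P0)| * T)%N%:R) <= l.
  apply: lE; apply: le_trans (_ : ((n_outputs psi + 2 * q) * a)%N%:R <= _).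
    by rewrite ler_nat; apply: events_card => // p; have [] := poptP p.
  rewrite natrM natrD natrM /m mulrAC ler_wpM2r// [leRHS]mulrDl; apply: lerD.
    apply: le_trans no_t (ler_wpM2l _ t4T).
    by apply: mulr_ge0 (sqr_ge0 n); exact: ler0n.
  by rewrite ler_peMr ?ler1n ?(ltnW T1)// mulr_ge0.
have l0 : 0 <= l by apply: le_trans lE; exact: ln_nat_ge0.
pose es := `|Kswap| * Num.sqrt ((n_outputs psi)%:R / T%:R).
have es0 : 0 <= es by rewrite mulr_ge0 ?sqrtr_ge0.
have esE : es <= `|Kswap| * s * tau ^+ 3.
  have st : 0 <= s * tau ^+ 3 by rewrite mulr_ge0// exprn_ge0// ltW.
  rewrite -mulrA ler_wpM2l// -[leRHS](ger0_norm st) -sqrtr_sqr ler_wsqrtr// TE.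
  rewrite (_ : (s * tau ^+ 3) ^+ 2 = s ^+ 2 * tau ^- 4 * tau ^+ 10).
    by rewrite ler_wpM2r// exprn_ge0// ltW.
  by field; rewrite gt_eqF.
(* The constants of the hypotheses are arbitrary reals; absolute values make them nonnegative. *)
have nsi' (w : seed F) : no_secret_information tb P0 L psi (forecasts w y) y `|Knsi|.
  have [H1 H2] := nsi w; split; first exact: no_secret_info_play_le (ler_norm _) H1.
  by move=> p0 /H2 H3; exact: no_secret_info_play_le (ler_norm _) H3.
have swap' (w : seed F) : no_contextual_swap_regret tb P0 L psi (forecasts w y) y es.
  have le_es : Kswap * Num.sqrt ((n_outputs psi)%:R / T%:R) <= es.
    by rewrite ler_wpM2r ?sqrtr_ge0// ler_norm.
  have [H1 H2] := swap w; split; first exact: le_trans H1 le_es.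
  by move=> p0 /H2 H3; exact: le_trans H3 le_es.
have sqrt_delta : Num.sqrt delta = tau / 4.
  rewrite deltaE (_ : tau ^+ 2 / 16 = (tau / 4) ^+ 2); last by field.
  by rewrite sqrtr_sqr ger0_norm// divr_ge0// ltW.
have lossb : 0 < x * (g ^+ 2 / 8) * beta / 2.
  by rewrite /x /beta tauE divr_gt0// !mulr_gt0// divr_gt0.
have gam0 : 0 <= Num.max x (Num.sqrt delta) by rewrite le_max sqrtr_ge0.
have c0 : 0 <= 3 * beta / (g ^+ 2 / 4) + 4 / g ^+ 2 * Num.sqrt eps + 2 * Num.sqrt delta.
  by rewrite !addr_ge0// ?mulr_ge0 ?invr_ge0 ?sqrtr_ge0// ?divr_ge0 ?(ltW g2).
have eps_gt0 : 0 < eps by rewrite epsE exprn_gt0.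
have := PR_le (ltnW T1) P0n0 (normr_ge0 Knsi) eps_gt0 lossb gam0 c0 es0 fin unb lE
  nsi' swap' orc.
move=> /le_trans; apply; rewrite lee_fin -/(n_outputs psi) -/a -/q.
have b_ge0 : 0 <= b.
  apply: mulr_ge0 => //; apply: addr_ge0; last exact: mulr_ge0.
  by apply: mulr_ge0 => //; exact: sqr_ge0.
have bl0 : 0 <= b * (1 + l) by apply: mulr_ge0 => //; exact: addr_ge0.
have B1 := bias_bound_le Kfc t01 TE s_ge0 l0 N1E (_ : _ * 1 <= _).
rewrite mulr1 in B1; have {}B1 := B1 N1E.
have B3 := bias_bound_le Kfc t01 TE s_ge0 l0 N3E N33E.
rewrite -/b in B1 B3.
have L1 : transfer_loss T `|Knsi| es (x * (g ^+ 2 / 8) * beta / 2)^-1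
    (n_outputs psi * a) (bias_bound T Kfc l (n_outputs psi * a) 1) <=
    (16 / g ^+ 2 * (`|Kswap| * s + `|Knsi| * s + 2 * (b * (1 + l))) +
      (`|Knsi| * s + b * (1 + l))) * tau.
  apply: transfer_loss_le => //; first by rewrite invr_ge0 ltW.
  rewrite /x /beta tauE le_eqVlt; apply/orP; left; apply/eqP.
  by field; rewrite !gt_eqF.
have L2 : transfer_loss T `|Knsi| es eps^-1 a (bias_bound T Kfc l (q * a) (q * a)%N%:R) <=
    (1 * (`|Kswap| * s + `|Knsi| * s + 2 * (b * (1 + l))) +
      (`|Knsi| * s + b * (1 + l))) * tau.
  apply: transfer_loss_le => //; first by rewrite invr_ge0 ltW.
  by rewrite mul1r epsE.
have A1 : 0 <= `|Kswap| * s by exact: mulr_ge0.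
have A2 : 0 <= `|Knsi| * s by exact: mulr_ge0.
have ZE kap : 0 <= kap -> (kap * (`|Kswap| * s + `|Knsi| * s + 2 * (b * (1 + l))) +
      (`|Knsi| * s + b * (1 + l))) * tau <= Z kap * (1 + l) * tau.
  by move=> kap0; rewrite ler_wpM2r ?(ltW t0)//; exact: rate_log_factor.
have kap0 : 0 <= 16 / g ^+ 2 by rewrite divr_ge0// ltW.
have {}L1 := le_trans L1 (ZE _ kap0); have {}L2 := le_trans L2 (ZE _ ler01).
have maxE : Num.max x (Num.sqrt delta) = tau.
  by rewrite sqrt_delta /x tauE max_l// ler_piMr ?(ltW t0)// invf_le1 ?ler1n.
have cE : 3 * beta / (g ^+ 2 / 4) + 4 / g ^+ 2 * Num.sqrt eps + 2 * Num.sqrt delta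
    + tau = (16 / g ^+ 2 + 3 / 2) * tau.
  by rewrite sqrt_delta tauE betaE; field; rewrite gt_eqF.
rewrite maxE cE.
have Z0 kap : 0 <= kap -> 0 <= Z kap.
  move=> k0; apply: addr_ge0; last exact: addr_ge0.
  by apply: mulr_ge0 => //; rewrite addr_ge0 ?addr_ge0// mulr_ge0.
have k_ge0 : 0 <= 16 / g ^+ 2 + 3 / 2 by rewrite addr_ge0// divr_ge0.
apply: le_trans (add_rates k_ge0 l0 (ltW t0) L1 L2) _.
rewrite ler_wpM2r ?(ltW t0)// -[leRHS]mulrA; apply: ler_wpM2l.
  by apply: addr_ge0; [apply: addr_ge0 => //|]; exact: Z0.
(* It remains to bound 1 by [ln T / ln 2], which holds because [T >= 2]. *)
rewrite mulrDl -/l lerD2r.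
by rewrite mul1r ler_pdivlMl// mulr1 ler_ln ?posrE// ler_nat.
Qed.
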